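(* Let $\mathcal{A}$ be an abelian category and let $(\mathcal{Q},\mathcal{W},\mathcal{R})$ be a hereditary Hovey triple in $\mathcal{A}$. For every integer $n\ge 0$ the following assertions hold. (1) If $(\mathcal{Q}_{\mathcal{W},n},\ \mathcal{Q}_{\mathcal{W},n}^{\perp})$ is a complete cotorsion pair, then $(\mathcal{Q}_n,\ \mathcal{W},\ \mathcal{Q}_{\mathcal{W},n}^{\perp})$ is a hereditary Hovey triple on $\mathcal{A}$. In this case, $(\mathcal{Q}_n,\mathcal{Q}_n^{\perp})$ is a complete hereditary cotorsion pair with $\mathcal{Q}_n^{\perp}=\mathcal{W}\cap\mathcal{Q}_{\mathcal{W},n}^{\perp}$, and $\mathcal{Q}_n$ is a special precovering class. (2) If $({}^{\perp}\mathcal{R}_{\mathcal{W},n},\ \mathcal{R}_{\mathcal{W},n})$ is a complete cotorsion pair, then $({}^{\perp}\mathcal{R}_{\mathcal{W},n},\ \mathcal{W},\ \mathcal{R}_n)$ is a hereditary Hovey triple on $\mathcal{A}$. In this case, $({}^{\perp}\mathcal{R}_n,\mathcal{R}_n)$ is a complete hereditary cotorsion pair with ${}^{\perp}\mathcal{R}_n=\mathcal{W}\cap{}^{\perp}\mathcal{R}_{\mathcal{W},n}$, and $\mathcal{R}_n$ is a special preenveloping class.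
   Context: $\mathcal{A}$ is not assumed to have enough projective or injective objects. All classes of objects are regarded as full additive subcategories closed under isomorphisms. Orthogonals: $\mathcal{X}^{\perp}=\{A\in\mathcal{A} : \mathrm{Ext}^1_{\mathcal{A}}(X,A)=0\ \forall X\in\mathcal{X}\}$ and ${}^{\perp}\mathcal{X}=\{A\in\mathcal{A} : \mathrm{Ext}^1_{\mathcal{A}}(A,X)=0\ \forall X\in\mathcal{X}\}$. A pair $(\mathcal{X},\mathcal{Y})$ is a cotorsion pair if $\mathcal{X}^{\perp}=\mathcal{Y}$ and $\mathcal{X}={}^{\perp}\mathcal{Y}$. It is left complete if every $A\in\mathcal{A}$ has a special $\mathcal{X}$-precover, i.e. there is a short exact sequence $0\to Y\to X\to A\to 0$ with $X\in\mathcal{X}$, $Y\in\mathcal{Y}$; right complete if every $A$ has a special $\mathcal{Y}$-preenvelope, i.e. there is a short exact sequence $0\to A\to Y\to X\to 0$ with $Y\in\mathcal{Y}$, $X\in\mathcal{X}$; complete if both. It is hereditary if $\mathrm{Ext}^i_{\mathcal{A}}(X,Y)=0$ for all $X\in\mathcal{X}$, $Y\in\mathcal{Y}$, $i\ge 1$. A class $\mathcal{X}$ is special precovering if every $A\in\mathcal{A}$ admits an epimorphism $X\to A$ with $X\in\mathcal{X}$ and kernel in $\mathcal{X}^{\perp}$ (then automatically every morphism $X'\to A$ with $X'\in\mathcal{X}$ factors through it); special preenveloping is dual (monomorphism $A\to X$ with $X\in\mathcal{X}$ and cokernel in ${}^{\perp}\mathcal{X}$). A class $\mathcal{W}$ is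 thick if it is closed under direct summands and whenever two of the three terms of a short exact sequence are in $\mathcal{W}$, so is the third. A Hovey triple is a triple $(\mathcal{Q},\mathcal{W},\mathcal{R})$ of classes with $\mathcal{W}$ thick and with $(\mathcal{Q},\mathcal{W}\cap\mathcal{R})$ and $(\mathcal{Q}\cap\mathcal{W},\mathcal{R})$ complete cotorsion pairs; it is hereditary if both cotorsion pairs are hereditary. (Hovey triples correspond to abelian model structures.) An object $A$ has $\mathcal{X}$-resolution dimension at most $n$ if there is an exact sequence $0\to X_n\to\cdots\to X_0\to A\to 0$ with all $X_i\in\mathcal{X}$; $\mathcal{X}$-coresolution dimension at most $n$ is defined dually ($0\to A\to X^0\to\cdots\to X^n\to 0$). $\mathcal{Q}_n$ is the class of objects of $\mathcal{Q}$-resolution dimension at most $n$; $\mathcal{R}_n$ is the class of objects of $\mathcal{R}$-coresolution dimension at most $n$. $\mathcal{Q}_{\mathcal{W}}:=\mathcal{Q}\cap\mathcal{W}$, $\mathcal{R}_{\mathcal{W}}:=\mathcal{W}\cap\mathcal{R}$; $\mathcal{Q}_{\mathcal{W},n}$ is the class of objects of $\mathcal{Q}_{\mathcal{W}}$-resolution dimension at most $n$, and $\mathcal{R}_{\mathcal{W},n}$ is the class of objects of $\mathcal{R}_{\mathcal{W}}$-coresolution dimension at most $n$. *)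

(* Defs.v *)
From Stdlib Require Import Relations.
From mathcomp Require Import all_boot all_order ssralg.
From mathcomp Require Import boolp classical_sets.

Set Implicit Arguments.
Unset Strict Implicit.
Unset Printing Implicit Defensive.

Declare Scope cat_scope.
Delimit Scope cat_scope with cat.
Local Open Scope classical_set_scope.
Local Open Scope ring_scope.
Local Open Scope cat_scope.

(* Under the classical axioms of [boolp] every abelian group carries a
   [zmodType] structure, so this covers all preadditive categories. *)
Record preadditive := Preadditive {
  obj :> Type;
  hom : obj -> obj -> zmodType;
  idm : forall A, hom A A;
  comp : forall A B D, hom B D -> hom A B -> hom A D;
  comp_idl : forall A B (f : hom A B), comp (idm B) f = f;
  comp_idr : forall A B (f : hom A B), comp f (idm A) = f;
  comp_assoc : forall A B D E (h : hom D E) (g : hom B D) (f : hom A B),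
    comp h (comp g f) = comp (comp h g) f;
  comp_addl : forall A B D (g g' : hom B D) (f : hom A B),
    comp (g + g') f = comp g f + comp g' f;
  comp_addr : forall A B D (g : hom B D) (f f' : hom A B),
    comp g (f + f') = comp g f + comp g f' }.

Arguments idm {p} A.
Notation "g ∘ f" := (comp g f) (at level 40, left associativity) : cat_scope.

Definition mono (C : preadditive) (A B : C) (f : hom A B) : Prop :=
  forall (T : C) (u v : hom T A), f ∘ u = f ∘ v -> u = v.

Definition epi (C : preadditive) (A B : C) (f : hom A B) : Prop :=
  forall (T : C) (u v : hom B T), u ∘ f = v ∘ f -> u = v.

Definition iso (C : preadditive) (A B : C) (f : hom A B) : Prop :=
  exists g : hom B A, g ∘ f = idm A /\ f ∘ g = idm B.

Definition is_zero (C : preadditive) (Z : C) : Prop :=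
  forall A : C, (forall f : hom Z A, f = 0) /\ (forall f : hom A Z, f = 0).

Definition is_biproduct (C : preadditive) (A B S : C) : Prop :=
  exists (i1 : hom A S) (i2 : hom B S) (p1 : hom S A) (p2 : hom S B),
    [/\ p1 ∘ i1 = idm A, p2 ∘ i2 = idm B, p1 ∘ i2 = 0, p2 ∘ i1 = 0
      & i1 ∘ p1 + i2 ∘ p2 = idm S].

Definition is_kernel (C : preadditive) (K A B : C)
    (k : hom K A) (f : hom A B) : Prop :=
  f ∘ k = 0 /\
  forall (T : C) (u : hom T A), f ∘ u = 0 -> exists! v : hom T K, k ∘ v = u.

Definition is_cokernel (C : preadditive) (A B D : C)
    (c : hom B D) (f : hom A B) : Prop :=
  c ∘ f = 0 /\
  forall (T : C) (u : hom B T), u ∘ f = 0 -> exists! v : hom D T, v ∘ c = u.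

Record abelian := Abelian {
  abelian_base :> preadditive;
  has_zero : exists Z : abelian_base, is_zero Z;
  has_biproducts : forall A B : abelian_base, exists S, is_biproduct A B S;
  has_kernels : forall (A B : abelian_base) (f : hom A B),
    exists (K : abelian_base) (k : hom K A), is_kernel k f;
  has_cokernels : forall (A B : abelian_base) (f : hom A B),
    exists (D : abelian_base) (c : hom B D), is_cokernel c f;
  mono_normal : forall (A B : abelian_base) (f : hom A B), mono f ->
    exists (D : abelian_base) (g : hom B D), is_kernel f g;
  epi_normal : forall (A B : abelian_base) (f : hom A B), epi f ->
    exists (D : abelian_base) (g : hom D A), is_cokernel f g }.

(* Exactness of A -> B -> D at B: the image of f is the kernel of g. *)
Definition exact (C : preadditive) (A B D : C)
    (f : hom A B) (g : hom B D) : Prop :=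
  exists (K : C) (k : hom K B) (e : hom A K),
    [/\ is_kernel k g, epi e & f = k ∘ e].

Definition short_exact (C : preadditive) (A B D : C)
    (f : hom A B) (g : hom B D) : Prop :=
  [/\ mono f, exact f g & epi g].

(* An exact sequence ... -> X_1 -> X_0 -> A -> 0; finite exact sequences
   0 -> X_n -> ... -> X_0 -> A -> 0 are those with X_i zero for i > n. *)
Record resolution (C : preadditive) (A : C) := Resolution {
  res_obj :> nat -> C;
  res_d : forall i, hom (res_obj i.+1) (res_obj i);
  res_aug : hom (res_obj 0) A;
  res_aug_epi : epi res_aug;
  res_exact0 : exact (res_d 0) res_aug;
  res_exactS : forall i, exact (res_d i.+1) (res_d i) }.

Record coresolution (C : preadditive) (A : C) := Coresolution {
  cores_obj :> nat -> C;
  cores_d : forall i, hom (cores_obj i) (cores_obj i.+1);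
  cores_aug : hom A (cores_obj 0);
  cores_aug_mono : mono cores_aug;
  cores_exact0 : exact cores_aug (cores_d 0);
  cores_exactS : forall i, exact (cores_d i) (cores_d i.+1) }.

Definition resdim_le (C : preadditive) (n : nat) (X : set C) : set C :=
  [set A | exists E : resolution A,
     (forall i, (i <= n)%N -> X (E i)) /\ (forall i, (n < i)%N -> is_zero (E i))].

Definition coresdim_le (C : preadditive) (n : nat) (X : set C) : set C :=
  [set A | exists E : coresolution A,
     (forall i, (i <= n)%N -> X (E i)) /\ (forall i, (n < i)%N -> is_zero (E i))].

(* A Yoneda n-extension 0 -> B -> E_(n-1) -> ... -> E_0 -> A -> 0 (n >= 1),
   as a resolution of A of length n together with an isomorphism B ~ E_n. *)
Record extension (C : preadditive) (n : nat) (A B : C) := Extension {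
  ext_res :> resolution A;
  ext_zero : forall i, (n < i)%N -> is_zero (ext_res i);
  ext_end : hom B (ext_res n);
  ext_end_iso : iso ext_end }.

(* Morphisms of extensions inducing the identity on both ends. *)
Definition extension_map (C : preadditive) (n : nat) (A B : C)
    (E F : extension n A B) : Prop :=
  exists f : forall i, hom (E i) (F i),
    [/\ forall i, f i ∘ res_d E i = res_d F i ∘ f i.+1,
        res_aug F ∘ f 0%N = res_aug E
      & f n ∘ ext_end E = ext_end F].

Definition yoneda_equiv (C : preadditive) (n : nat) (A B : C) :
    relation (extension n A B) :=
  clos_refl_sym_trans (extension n A B) (@extension_map C n A B).

(* Ext^n(A, B), n >= 1, is the group of n-extensions up to [yoneda_equiv];
   it vanishes when it has only one element. *)
Definition Ext_vanishes (C : preadditive) (n : nat) (A B : C) : Prop :=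
  forall E F : extension n A B, yoneda_equiv E F.

Definition rperp (C : preadditive) (X : set C) : set C :=
  [set A | forall B, X B -> Ext_vanishes 1 B A].

Definition lperp (C : preadditive) (X : set C) : set C :=
  [set A | forall B, X B -> Ext_vanishes 1 A B].

Definition cotorsion_pair (C : preadditive) (X Y : set C) : Prop :=
  rperp X = Y /\ X = lperp Y.

Definition left_complete (C : preadditive) (X Y : set C) : Prop :=
  forall A : C, exists (B D : C) (f : hom B D) (g : hom D A),
    [/\ short_exact f g, X D & Y B].

Definition right_complete (C : preadditive) (X Y : set C) : Prop :=
  forall A : C, exists (B D : C) (f : hom A B) (g : hom B D),
    [/\ short_exact f g, Y B & X D].

Definition complete_cotorsion_pair (C : preadditive) (X Y : set C) : Prop :=
  [/\ cotorsion_pair X Y, left_complete X Y & right_complete X Y].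

Definition hereditary (C : preadditive) (X Y : set C) : Prop :=
  forall (A B : C) (i : nat), X A -> Y B -> (1 <= i)%N -> Ext_vanishes i A B.

Definition special_precovering (C : preadditive) (X : set C) : Prop :=
  forall A : C, exists (D : C) (p : hom D A),
    [/\ X D, epi p
      & exists (K : C) (k : hom K D), is_kernel k p /\ rperp X K].

Definition special_preenveloping (C : preadditive) (X : set C) : Prop :=
  forall A : C, exists (D : C) (j : hom A D),
    [/\ X D, mono j
      & exists (K : C) (c : hom D K), is_cokernel c j /\ lperp X K].

Definition additive_class (C : preadditive) (X : set C) : Prop :=
  [/\ forall Z, is_zero Z -> X Z,
      forall A B S, is_biproduct A B S -> X A -> X B -> X S
    & forall A B (f : hom A B), iso f -> X A -> X B].

Definition thick (C : preadditive) (W : set C) : Prop :=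
  (forall A B S, is_biproduct A B S -> W S -> W A) /\
  (forall (A B D : C) (f : hom A B) (g : hom B D), short_exact f g ->
     [/\ W A -> W B -> W D, W A -> W D -> W B & W B -> W D -> W A]).

Definition hovey_triple (C : preadditive) (Q W R : set C) : Prop :=
  [/\ [/\ additive_class Q, additive_class W & additive_class R],
      thick W,
      complete_cotorsion_pair Q (W `&` R)
    & complete_cotorsion_pair (Q `&` W) R].

Definition hereditary_hovey_triple (C : preadditive) (Q W R : set C) : Prop :=
  [/\ hovey_triple Q W R, hereditary Q (W `&` R) & hereditary (Q `&` W) R].

(* Main.v *)
(* Everything is reduced to (1), since (2) is (1) in the opposite category.

   As Q is the left half of a complete hereditary cotorsion pair, it is
   resolving, so Q_n is closed under extensions by Q on either side and under
   syzygies with respect to Q. Special Q-precovers of an object of W lie in W,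
   hence Q_n /\ W = Q_(W,n). To see that Z in W /\ Q_(W,n)^perp is right
   orthogonal to A in Q_n, embed A into some B in W /\ R with cokernel in Q:
   then B is in Q_(W,n), and Ext^1(A, Z) sits between Ext^1(B, Z) = 0 and
   Ext^2(Q, Z) = 0. The approximations for Q_n are obtained by composing those
   of (Q, W /\ R) with those of (Q_(W,n), Q_(W,n)^perp).

   Yoneda Ext enters through two facts. A 2-extension is trivial only if its
   middle arrow E1 -> E0 factors as a mono E1 -> M followed by an epi M -> E0
   with the same kernel as E1 -> E0; this condition is self-dual. Conversely,
   Ext^i(X, B) = 0 for all i >= 1 as soon as Ext^1(X, B) = 0 and every epi onto
   an object of X is dominated by an epi X0 -> A from X with kernel in X:
   two i-extensions of A are then both dominated by extensions starting with
   X0 -> A, and one concludes by induction on i. *)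
Require Import Defs.
From mathcomp Require Import all_boot all_order ssralg.
From mathcomp Require Import boolp classical_sets.
From Stdlib Require Import Relations.
Import GRing.Theory.

Set Implicit Arguments.
Unset Strict Implicit.
Unset Printing Implicit Defensive.

Local Open Scope classical_set_scope.
Local Open Scope ring_scope.
Local Open Scope cat_scope.

(** * Kernels, short exact sequences and pullbacks *)

Section Preadditive.
Variable C : preadditive.
Implicit Types A B D E K T : C.

Lemma comp0l A B D (f : hom A B) : (0 : hom B D) ∘ f = 0.
Proof. by apply: (addrI (0 ∘ f)); rewrite -comp_addl !addr0. Qed.

Lemma comp0r A B D (g : hom B D) : g ∘ (0 : hom A B) = 0.
Proof. by apply: (addrI (g ∘ 0)); rewrite -comp_addr !addr0. Qed.

Lemma compNl A B D (g : hom B D) (f : hom A B) : (- g) ∘ f = - (g ∘ f).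
Proof. by apply: (addrI (g ∘ f)); rewrite -comp_addl !subrr comp0l. Qed.

Lemma compNr A B D (g : hom B D) (f : hom A B) : g ∘ (- f) = - (g ∘ f).
Proof. by apply: (addrI (g ∘ f)); rewrite -comp_addr !subrr comp0r. Qed.

Lemma compBl A B D (g g' : hom B D) (f : hom A B) :
  (g - g') ∘ f = g ∘ f - g' ∘ f.
Proof. by rewrite comp_addl compNl. Qed.

Lemma compBr A B D (g : hom B D) (f f' : hom A B) :
  g ∘ (f - f') = g ∘ f - g ∘ f'.
Proof. by rewrite comp_addr compNr. Qed.

Lemma monoP A B (f : hom A B) :
  mono f <-> forall T (u : hom T A), f ∘ u = 0 -> u = 0.
Proof.
split=> [fm T u fu|f0 T u v fuv]; first by apply: fm; rewrite fu comp0r.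
by apply/subr0_eq/f0; rewrite compBr fuv subrr.
Qed.

Lemma epiP A B (f : hom A B) :
  epi f <-> forall T (u : hom B T), u ∘ f = 0 -> u = 0.
Proof.
split=> [fm T u fu|f0 T u v fuv]; first by apply: fm; rewrite fu comp0l.
by apply/subr0_eq/f0; rewrite compBl fuv subrr.
Qed.

Lemma mono_comp A B D (g : hom B D) (f : hom A B) :
  mono g -> mono f -> mono (g ∘ f).
Proof. by move=> gm fm T u v; rewrite -!comp_assoc => /gm/fm. Qed.

Lemma epi_comp A B D (g : hom B D) (f : hom A B) :
  epi g -> epi f -> epi (g ∘ f).
Proof. by move=> gm fm T u v; rewrite !comp_assoc => /fm/gm. Qed.

Lemma mono_compr A B D (g : hom B D) (f : hom A B) :
  mono (g ∘ f) -> mono f.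
Proof. by move=> gfm T u v fuv; apply: gfm; rewrite -!comp_assoc fuv. Qed.

Lemma epi_compl A B D (g : hom B D) (f : hom A B) :
  epi (g ∘ f) -> epi g.
Proof. by move=> gfm T u v fuv; apply: gfm; rewrite !comp_assoc fuv. Qed.

Lemma mono_idm A : mono (idm A).
Proof. by move=> T u v; rewrite !comp_idl. Qed.

Lemma epi_idm A : epi (idm A).
Proof. by move=> T u v; rewrite !comp_idr. Qed.

Lemma kernel_mono K A B (k : hom K A) (f : hom A B) : is_kernel k f -> mono k.
Proof.
move=> [fk ker] T u v kuv.
have [w [_ w_uniq]] : exists! w, k ∘ w = k ∘ v.
  by apply: ker; rewrite comp_assoc fk comp0l.
by rewrite -(w_uniq u kuv) (w_uniq v erefl).
Qed.

Lemma kernel_lift K A B (k : hom K A) (f : hom A B) T (u : hom T A) :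
  is_kernel k f -> f ∘ u = 0 -> exists v, k ∘ v = u.
Proof. by move=> [_ ker] /ker[v [kv _]]; exists v. Qed.

Lemma kernelI K A B (k : hom K A) (f : hom A B) :
  mono k -> f ∘ k = 0 ->
  (forall T (u : hom T A), f ∘ u = 0 -> exists v, k ∘ v = u) -> is_kernel k f.
Proof.
move=> km fk lift; split=> // T u /lift[v kv]; exists v; split=> // w kw.
by apply: km; rewrite kv.
Qed.

Lemma cokernel_epi A B D (c : hom B D) (f : hom A B) : is_cokernel c f -> epi c.
Proof.
move=> [cf cok] T u v ucv.
have [w [_ w_uniq]] : exists! w, w ∘ c = v ∘ c.
  by apply: cok; rewrite -comp_assoc cf comp0r.
by rewrite -(w_uniq u ucv) (w_uniq v erefl).
Qed.

Lemma cokernel_desc A B D (c : hom B D) (f : hom A B) T (u : hom B T) :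
  is_cokernel c f -> u ∘ f = 0 -> exists v, v ∘ c = u.
Proof. by move=> [_ cok] /cok[v [kv _]]; exists v. Qed.

Lemma cokernelI A B D (c : hom B D) (f : hom A B) :
  epi c -> c ∘ f = 0 ->
  (forall T (u : hom B T), u ∘ f = 0 -> exists v, v ∘ c = u) -> is_cokernel c f.
Proof.
move=> ce cf desc; split=> // T u /desc[v vc]; exists v; split=> // w wc.
by apply: ce; rewrite vc.
Qed.

Lemma is_zeroP (Z : C) : is_zero Z <-> idm Z = 0.
Proof.
split=> [Z0|idZ A]; first by case: (Z0 Z) => /(_ (idm Z)).
split=> f; first by rewrite -[f]comp_idr idZ comp0r.
by rewrite -[f]comp_idl idZ comp0l.
Qed.

Lemma zero_from Z A (f : hom Z A) : is_zero Z -> f = 0.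
Proof. by move=> Z0; case: (Z0 A) => /(_ f). Qed.

Lemma zero_to Z A (f : hom A Z) : is_zero Z -> f = 0.
Proof. by move=> Z0; case: (Z0 A) => _ /(_ f). Qed.

(** Encoded as a kernel-cokernel pair, so that passing to the opposite category only swaps the two
    conjuncts; [short_exactP] relates it to [short_exact]. *)
Definition ses A B D (f : hom A B) (g : hom B D) : Prop :=
  is_kernel f g /\ is_cokernel g f.

Lemma ses_comp0 A B D (f : hom A B) (g : hom B D) : ses f g -> g ∘ f = 0.
Proof. by case=> -[]. Qed.

Lemma ses_mono A B D (f : hom A B) (g : hom B D) : ses f g -> mono f.
Proof. by case=> /kernel_mono. Qed.

Lemma ses_epi A B D (f : hom A B) (g : hom B D) : ses f g -> epi g.
Proof. by case=> _ /cokernel_epi. Qed.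

Lemma ses_section A B D (f : hom A B) (g : hom B D) (r : hom B A) :
  ses f g -> r ∘ f = idm A -> exists s : hom D B, g ∘ s = idm D.
Proof.
move=> fg rf.
have /(cokernel_desc fg.2)[s sg] : (idm B - f ∘ r) ∘ f = 0.
  by rewrite compBl comp_idl -comp_assoc rf comp_idr subrr.
exists s; apply: (ses_epi fg).
by rewrite -comp_assoc sg compBr comp_idr comp_idl comp_assoc (ses_comp0 fg)
           comp0l subr0.
Qed.

Lemma ses_retraction A B D (f : hom A B) (g : hom B D) (s : hom D B) :
  ses f g -> g ∘ s = idm D -> exists r : hom B A, r ∘ f = idm A.
Proof.
move=> fg gs.
have /(kernel_lift fg.1)[r fr] : g ∘ (idm B - s ∘ g) = 0.
  by rewrite compBr comp_idr comp_assoc gs comp_idl subrr.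
exists r; apply: (ses_mono fg).
by rewrite comp_assoc fr compBl comp_idr comp_idl -comp_assoc (ses_comp0 fg)
           comp0r subr0.
Qed.

(** The splitting form of Ext^1(A, B) = 0; [Ext_vanishes1P] identifies it with the Yoneda form. *)
Definition ext1_zero A B : Prop :=
  forall E (f : hom B E) (g : hom E A), ses f g -> exists r, r ∘ f = idm B.

Definition is_pullback P A B D (p : hom P A) (q : hom P B)
    (f : hom A D) (g : hom B D) : Prop :=
  [/\ f ∘ p = g ∘ q,
      forall T (u : hom T A) (v : hom T B), f ∘ u = g ∘ v ->
        exists w, p ∘ w = u /\ q ∘ w = v
    & forall T (u v : hom T P), p ∘ u = p ∘ v -> q ∘ u = q ∘ v -> u = v].

Lemma is_pullbackC P A B D (p : hom P A) (q : hom P B)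
    (f : hom A D) (g : hom B D) : is_pullback p q f g -> is_pullback q p g f.
Proof.
move=> [e lift inj]; split=> // [T u v uv|T u v uv1 uv2]; last exact: inj.
by have [w []] := lift T v u (esym uv); exists w.
Qed.

Lemma pullback_kernel P A B D K (p : hom P A) (q : hom P B)
    (f : hom A D) (g : hom B D) (k : hom K B) :
  is_pullback p q f g -> is_kernel k g ->
  exists k' : hom K P, is_kernel k' p /\ q ∘ k' = k.
Proof.
move=> [e lift inj] ker.
have [k' [pk qk]] : exists k' : hom K P, p ∘ k' = 0 /\ q ∘ k' = k.
  by apply: lift; rewrite comp0r ker.1.
exists k'; split=> //; apply: kernelI => //.
  by apply: (@mono_compr _ _ _ q); rewrite qk; apply: kernel_mono ker.
move=> T u pu.
have /(kernel_lift ker)[v kv] : g ∘ (q ∘ u) = 0.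
  by rewrite comp_assoc -e -comp_assoc pu comp0r.
by exists v; apply: inj; rewrite comp_assoc ?pk ?qk // comp0l.
Qed.

End Preadditive.

(** * The opposite category *)

Section Opposite.

(** Kept transparent, like [op] below, so that statements about the opposite category convert to the
    dual statements. *)
Definition op_preadditive (C : preadditive) : preadditive.
Proof.
refine (@Preadditive C (fun A B => hom B A) (fun A => idm A)
  (fun A B D g f => f ∘ g) _ _ _ _ _).
- by move=> A B f; rewrite comp_idr.
- by move=> A B f; rewrite comp_idl.
- by move=> A B D E h g f; rewrite comp_assoc.
- by move=> A B D g g' f; rewrite comp_addr.
- by move=> A B D g f f'; rewrite comp_addl.
Defined.

Lemma is_zero_op (C : preadditive) (Z : C) :
  is_zero (C := op_preadditive C) Z <-> is_zero Z.
Proof. by split=> Z0 A; have [from_Z to_Z] := Z0 A; split. Qed.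

Lemma is_biproduct_op (C : preadditive) (A B S : C) :
  is_biproduct (C := op_preadditive C) A B S <-> is_biproduct A B S.
Proof.
split=> -[i1 [i2 [p1 [p2 [h1 h2 h3 h4 h5]]]]];
  by exists p1, p2, i1, i2; split.
Qed.

Definition op (C : abelian) : abelian.
Proof.
refine (@Abelian (op_preadditive C) _ _ _ _ _ _).
- by have [Z Z0] := has_zero C; exists Z; apply/is_zero_op.
- move=> A B; have [S bS] := @has_biproducts C A B; exists S.
  exact/is_biproduct_op.
- by move=> A B f; have [D [c cok]] := @has_cokernels C B A f; exists D, c.
- by move=> A B f; have [K [k ker]] := @has_kernels C B A f; exists K, k.
- by move=> A B f /(@epi_normal C B A f)[D [g cok]]; exists D, g.
- by move=> A B f /(@mono_normal C B A f)[D [g cok]]; exists D, g.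
Defined.

End Opposite.

(** * Diagram lemmas in abelian categories *)

Section AbelianKernels.
Variable C : abelian.
Implicit Types A B D E K T P : C.

(** As [f] is the kernel of some [g], and [g] factors through [c], an arrow killed by [c] is killed
    by [g] and lifts along [f]. *)
Lemma mono_is_kernel A B D (f : hom A B) (c : hom B D) :
  mono f -> is_cokernel c f -> is_kernel f c.
Proof.
move=> fm cok; have [G [g ker]] := mono_normal fm.
apply: kernelI => // [|T u cu]; first exact: cok.1.
have [g' g'c] := cokernel_desc cok ker.1.
by apply: (kernel_lift ker); rewrite -g'c -comp_assoc cu comp0r.
Qed.
End AbelianKernels.

Section Abelian.
Variable C : abelian.
Implicit Types A B D E K T P : C.

Lemma epi_is_cokernel A B K (g : hom A B) (k : hom K A) :
  epi g -> is_kernel k g -> is_cokernel g k.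
Proof. exact: (@mono_is_kernel (op C) B A K g k). Qed.

Lemma ses_of_kernel A B D (f : hom A B) (g : hom B D) :
  is_kernel f g -> epi g -> ses f g.
Proof. by move=> ker ge; split=> //; apply: epi_is_cokernel. Qed.

Lemma ses_of_cokernel A B D (f : hom A B) (g : hom B D) :
  is_cokernel g f -> mono f -> ses f g.
Proof. by move=> ker ge; split=> //; apply: mono_is_kernel. Qed.

Lemma epi_ses A B (g : hom A B) : epi g -> exists K (k : hom K A), ses k g.
Proof.
move=> ge; have [K [k ker]] := has_kernels g.
by exists K, k; apply: ses_of_kernel.
Qed.

Lemma mono_epi_iso A B (f : hom A B) : mono f -> epi f -> iso f.
Proof.
move=> fm fe; have [D [g ker]] := mono_normal fm.
have g0 : g = 0 by move/epiP: fe; apply; exact: ker.1.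
have [v fv] : exists v, f ∘ v = idm B.
  by apply: (kernel_lift ker); rewrite g0 comp0l.
by exists v; split=> //; apply: fm; rewrite comp_assoc fv comp_idl comp_idr.
Qed.

Lemma exact_comp0 A B D (f : hom A B) (g : hom B D) : exact f g -> g ∘ f = 0.
Proof. by move=> [K [k [e [ker _ ->]]]]; rewrite comp_assoc ker.1 comp0l. Qed.

Lemma exact_mono_kernel A B D (f : hom A B) (g : hom B D) :
  exact f g -> mono f -> is_kernel f g.
Proof.
move=> fg fm; have gf := exact_comp0 fg; have [K [k [e [ker ee fke]]]] := fg.
have [e' [_ ee']] : iso e.
  by apply: mono_epi_iso => //; apply: (@mono_compr _ _ _ _ k); rewrite -fke.
apply: kernelI => // T u /(kernel_lift ker)[w kw]; exists (e' ∘ w).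
by rewrite fke -comp_assoc [e ∘ _]comp_assoc ee' comp_idl.
Qed.

Lemma short_exactP A B D (f : hom A B) (g : hom B D) :
  short_exact f g <-> ses f g.
Proof.
split=> [[fm fg ge]|fg].
  exact: ses_of_kernel (exact_mono_kernel fg fm) ge.
split; [exact: ses_mono fg| |exact: ses_epi fg].
by exists A, f, (idm A); split; [exact: fg.1|exact: epi_idm|rewrite comp_idr].
Qed.

(** The image is the kernel [k] of the cokernel of [f]. If [u] kills [e], then [f] factors through
    the smaller mono [k ∘ k'] with [k'] the kernel of [u]. Being a kernel itself, that mono already
    contains [k], so [k'] is a split epi and [u] is zero. *)
Lemma image_factorization A B (f : hom A B) :
  exists K (m : hom K B) (e : hom A K), [/\ mono m, epi e & f = m ∘ e].
Proof.
have [D [c cok]] := has_cokernels f; have [K [k ker]] := has_kernels c.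
have [e ke] := kernel_lift ker cok.1.
exists K, k, e; split=> //; first exact: kernel_mono ker.
apply/epiP => T u ue; have [K' [k' ker']] := has_kernels u.
have [e' k'e'] := kernel_lift ker' ue.
have kk'm : mono (k ∘ k').
  by apply: mono_comp; [exact: kernel_mono ker|exact: kernel_mono ker'].
have [D' [c' cok']] := has_cokernels (k ∘ k').
have ker2 := mono_is_kernel kk'm cok'.
have [c'' c''c] : exists c'', c'' ∘ c = c'.
  apply: (cokernel_desc cok).
  by rewrite -ke -k'e' [k ∘ _]comp_assoc comp_assoc cok'.1 comp0l.
have [w kk'w] : exists w, (k ∘ k') ∘ w = k.
  by apply: (kernel_lift ker2); rewrite -c''c -comp_assoc ker.1 comp0r.
have k'w : k' ∘ w = idm K.
  by apply: (kernel_mono ker); rewrite comp_assoc comp_idr.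
by rewrite -[u]comp_idr -k'w comp_assoc ker'.1 comp0l.
Qed.

(** While [exact] is phrased with the kernel of [g], this is the phrasing with the cokernel of [f]:
    exactness is self-dual. *)
Lemma exact_cokernel A B D (f : hom A B) (g : hom B D) :
  exact f g -> exists K (k : hom B K) (e : hom K D),
    [/\ is_cokernel k f, mono e & g = e ∘ k].
Proof.
move=> [K [k [e [ker ee fke]]]].
have [L [m [q [mm qe gmq]]]] := image_factorization g.
have kerq : is_kernel k q.
  apply: kernelI => [||T u qu]; first exact: kernel_mono ker.
    by apply: mm; rewrite comp_assoc -gmq ker.1 comp0r.
  by apply: (kernel_lift ker); rewrite gmq -comp_assoc qu comp0r.
exists L, q, m; split=> //; apply: cokernelI => //.
  by rewrite fke comp_assoc kerq.1 comp0l.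
move=> T u uf; apply: (cokernel_desc (epi_is_cokernel qe kerq)).
by apply: ee; rewrite -comp_assoc -fke comp0l.
Qed.

Lemma exists_pullback A B D (f : hom A D) (g : hom B D) :
  exists P (p : hom P A) (q : hom P B), is_pullback p q f g.
Proof.
have [S [i1 [i2 [p1 [p2 [p1i1 p2i2 p1i2 p2i1 sum]]]]]] := has_biproducts A B.
have [P [k ker]] := has_kernels (f ∘ p1 - g ∘ p2).
exists P, (p1 ∘ k), (p2 ∘ k); split.
- by apply/subr0_eq; rewrite !comp_assoc -compBl ker.1.
- move=> T u v uv.
  have [w kw] : exists w, k ∘ w = i1 ∘ u + i2 ∘ v.
    apply: (kernel_lift ker).
    rewrite compBl !comp_addr -!comp_assoc ![p1 ∘ (_ ∘ _)]comp_assoc.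
    rewrite ![p2 ∘ (_ ∘ _)]comp_assoc p1i1 p1i2 p2i1 p2i2 !comp_idl !comp0l.
    by rewrite !comp0r addr0 add0r uv subrr.
  exists w; rewrite -!comp_assoc kw !comp_addr !comp_assoc.
  by rewrite p1i1 p1i2 p2i1 p2i2 !comp_idl !comp0l addr0 add0r.
- move=> T u v; rewrite -!comp_assoc => e1 e2; apply: (kernel_mono ker).
  rewrite -[k ∘ u]comp_idl -[k ∘ v]comp_idl -sum !comp_addl -!comp_assoc.
  by rewrite e1 e2.
Qed.

(** The pullback is the kernel of [d] on the biproduct, and [d] is epi because it restricts to
    [- g]; so [d] is the cokernel of [k]. If [u ∘ p = 0], then [u ∘ p1] is some [t ∘ d], and
    restricting to the summand [B] gives [t = 0]. *)
Lemma pullback_epi P A B D (p : hom P A) (q : hom P B)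
    (f : hom A D) (g : hom B D) : is_pullback p q f g -> epi g -> epi p.
Proof.
move=> [e lift inj] ge.
have [S [i1 [i2 [p1 [p2 [p1i1 p2i2 p1i2 p2i1 sum]]]]]] := has_biproducts A B.
pose k := i1 ∘ p + i2 ∘ q; pose d := f ∘ p1 - g ∘ p2.
have p1k : p1 ∘ k = p.
  by rewrite comp_addr !comp_assoc p1i1 p1i2 comp_idl comp0l addr0.
have p2k : p2 ∘ k = q.
  by rewrite comp_addr !comp_assoc p2i1 p2i2 comp_idl comp0l add0r.
have di2 : d ∘ i2 = - g.
  by rewrite compBl -!comp_assoc p1i2 p2i2 comp0r comp_idr sub0r.
have ker : is_kernel k d.
  apply: kernelI => [T u v kuv||T u].
  - by apply: inj; rewrite -?p1k -?p2k -!comp_assoc kuv.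
  - by rewrite compBl -!comp_assoc p1k p2k e subrr.
  - rewrite compBl -!comp_assoc => /subr0_eq/lift[w [pw qw]]; exists w.
    by rewrite comp_addl -!comp_assoc pw qw !comp_assoc -comp_addl sum comp_idl.
have ti2 T (t : hom D T) : t ∘ (d ∘ i2) = 0 -> t = 0.
  rewrite di2 compNr -compNl => /((epiP g).1 ge)/eqP.
  by rewrite oppr_eq0 => /eqP.
have cok : is_cokernel d k.
  apply: epi_is_cokernel ker; apply/epiP => T t td.
  by apply: ti2; rewrite comp_assoc td comp0l.
apply/epiP => T u; rewrite -p1k comp_assoc => /(cokernel_desc cok)[t tE].
have t0 : t = 0 by apply: ti2; rewrite comp_assoc tE -comp_assoc p1i2 comp0r.
by rewrite -[u]comp_idr -p1i1 comp_assoc -tE t0 !comp0l.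
Qed.

Lemma pullback_of_ses P A B D K (p : hom P A) (q : hom P B)
    (f : hom A D) (g : hom B D) (k : hom K B) :
  is_pullback p q f g -> ses k g ->
  exists k' : hom K P, ses k' p /\ q ∘ k' = k.
Proof.
move=> pb kg; have [k' [ker qk']] := pullback_kernel pb kg.1.
by exists k'; split=> //; apply: ses_of_kernel (pullback_epi pb (ses_epi kg)).
Qed.

Lemma pullback_ses A B D K (h : hom A D) (k : hom K B) (g : hom B D) :
  ses k g -> exists P (k' : hom K P) (g' : hom P A) (h' : hom P B),
    [/\ ses k' g', h' ∘ k' = k & is_pullback g' h' h g].
Proof.
move=> kg; have [P [p [q pb]]] := exists_pullback h g.
by have [k' [pk' qk']] := pullback_of_ses pb kg; exists P, k', p, q.
Qed.

Lemma pullback_ses2 A B D K L (k : hom K B) (g : hom B D)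
    (l : hom L A) (h : hom A D) :
  ses k g -> ses l h ->
  exists P (k' : hom K P) (g' : hom P A) (l' : hom L P) (h' : hom P B),
    ses k' g' /\ ses l' h'.
Proof.
move=> kg lh; have [P [p [q pb]]] := exists_pullback h g.
have [k' [kp _]] := pullback_of_ses pb kg.
have [l' [lq _]] := pullback_of_ses (is_pullbackC pb) lh.
by exists P, k', p, l', q.
Qed.

(** The kernel [L] of the composite epi is the preimage of [K] in [E], hence a pullback and an
    extension of [K] by [K']. *)
Lemma noether_ses K P D K' E (k : hom K P) (g : hom P D)
    (k' : hom K' E) (q : hom E P) :
  ses k g -> ses k' q ->
  exists L (l : hom L E) (j : hom K' L) (q' : hom L K),
    [/\ ses l (g ∘ q), ses j q' & l ∘ j = k'].
Proof.
move=> kg k'q; have [L [q' [l pb]]] := exists_pullback k q.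
have [j [jq' lj]] := pullback_of_ses pb k'q; have [e lift inj] := pb.
exists L, l, j, q'; split=> //.
apply: ses_of_kernel; last exact: epi_comp (ses_epi kg) (ses_epi k'q).
apply: kernelI.
- move=> T u v luv; apply: inj => //; apply: (ses_mono kg).
  by rewrite !comp_assoc e -!comp_assoc luv.
- by rewrite -comp_assoc -e comp_assoc (ses_comp0 kg) comp0l.
- move=> T u; rewrite -comp_assoc => /(kernel_lift kg.1)[v kv].
  by have [w [_ lw]] := lift _ v u kv; exists w.
Qed.

End Abelian.

(** * Yoneda extensions *)

Section Extensions.
Variable C : abelian.
Implicit Types A B D E K T X Z : C.

Lemma exact_epi_cokernel A B D (f : hom A B) (g : hom B D) :
  exact f g -> epi g -> is_cokernel g f.
Proof.
move=> fg ge; have [K [k [e [ker ee fke]]]] := fg.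
apply: cokernelI => //; first exact: exact_comp0 fg.
move=> T u uf; apply: (cokernel_desc (epi_is_cokernel ge ker)).
by apply: ee; rewrite comp0l -comp_assoc -fke.
Qed.

Lemma exact_from_zero A B D (f : hom A B) (g : hom B D) :
  exact f g -> is_zero A -> mono g.
Proof.
move=> [K [k [e [ker ee _]]]] A0; apply/monoP => T u /(kernel_lift ker)[v <-].
have -> : k = 0 by apply: ee; rewrite !(zero_from (_ ∘ _) A0).
by rewrite comp0l.
Qed.

Lemma exact_mono_comp A B D E (f : hom A B) (g : hom B D) (m : hom D E) :
  mono m -> exact f (m ∘ g) <-> exact f g.
Proof.
move=> mm; suff ker K (k : hom K B) : is_kernel k (m ∘ g) <-> is_kernel k g.
  by split=> -[K [k [e [/ker kerk ee fke]]]]; exists K, k, e.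
split=> kerk; apply: kernelI (kernel_mono kerk) _ _ => [|T u gu].
- by apply: mm; rewrite comp_assoc kerk.1 comp0r.
- by apply: (kernel_lift kerk); rewrite -comp_assoc gu comp0r.
- by rewrite -comp_assoc kerk.1 comp0r.
- by apply: (kernel_lift kerk); apply: mm; rewrite comp_assoc gu comp0r.
Qed.

Lemma exact_at_zero A B D (f : hom A B) (g : hom B D) : is_zero B -> exact f g.
Proof.
move=> B0; exists B, (idm B), f; split; last by rewrite comp_idl.
  apply: kernelI (@mono_idm _ _) _ _ => [|T u _]; first exact: zero_from.
  by exists u; rewrite comp_idl.
by move=> T u v _; rewrite (zero_from u B0) (zero_from v B0).
Qed.

Lemma exact_zero_mono A B D (f : hom A B) (g : hom B D) :
  is_zero A -> mono g -> exact f g.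
Proof.
move=> A0 gm; exists A, f, (idm A); split; last by rewrite comp_idr.
  apply: kernelI => [T u v _||T u gu].
    by rewrite (zero_to u A0) (zero_to v A0).
    exact: zero_from.
  by exists 0; rewrite comp0r; apply: gm; rewrite gu comp0r.
exact: epi_idm.
Qed.

(** * Splicing of resolutions and extensions *)

Definition single_resolution Z (Z0 : is_zero Z) A : resolution A.
Proof.
apply: (@Resolution C A (fun i => if i is _.+1 then Z else A) (fun _ => 0)
  (idm A)).
- exact: epi_idm.
- exact: exact_zero_mono Z0 (@mono_idm _ _).
- by move=> i; apply: exact_at_zero.
Defined.

(** The Yoneda splice of a short exact sequence with a resolution of its kernel. *)
Definition cons_resolution K X A (k : hom K X) (p : hom X A) (kp : ses k p)
  (E : resolution K) : resolution A.
Proof.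
apply: (@Resolution C A (fun i => if i is j.+1 then E j else X)
  (fun i => match i with 0%N => k ∘ res_aug E | j.+1 => res_d E j end) p).
- exact: ses_epi kp.
- by exists K, k, (res_aug E); split=> //; [exact: kp.1|exact: res_aug_epi].
- case=> [|i]; last exact: res_exactS.
  exact/(exact_mono_comp _ _ (ses_mono kp))/res_exact0.
Defined.

(** The innermost term of iterated splices: a short exact sequence becomes a 1-extension when
    spliced with this one. *)
Definition trivial_extension Z (Z0 : is_zero Z) B : extension 0 B B.
Proof.
apply: (@Extension C 0 B B (single_resolution Z0 B) _ (idm B)).
- by case.
- by exists (idm B); rewrite comp_idl.
Defined.

Definition cons_extension n K X A B (k : hom K X) (p : hom X A) (kp : ses k p)
  (E : extension n K B) : extension n.+1 A B.
Proof.
apply: (@Extension C n.+1 A B (cons_resolution kp E) _ (ext_end E)).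
- by case=> // i; exact: (@ext_zero _ _ _ _ E i).
- exact: ext_end_iso.
Defined.

Lemma cons_extension_map n K X A B (k : hom K X) (p : hom X A) (kp : ses k p)
    (E F : extension n K B) :
  extension_map E F ->
  extension_map (cons_extension kp E) (cons_extension kp F).
Proof.
move=> [f [fd fa fe]].
exists (fun i => match i return
    hom (cons_resolution kp E i) (cons_resolution kp F i) with
  | 0%N => idm X | j.+1 => f j end); split=> //=.
- case=> [|i] //=.
  by rewrite comp_idl -comp_assoc fa.
- by rewrite comp_idr.
Qed.

Lemma cons_extension_equiv n K X A B (k : hom K X) (p : hom X A) (kp : ses k p)
    (E F : extension n K B) :
  yoneda_equiv E F -> yoneda_equiv (cons_extension kp E) (cons_extension kp F).
Proof.
elim=> [E' F' EF|E'|E' F' _ IH|E' F' G' _ IH1 _ IH2].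
- exact/rst_step/cons_extension_map.
- exact: rst_refl.
- exact: rst_sym.
- exact: rst_trans IH1 IH2.
Qed.

Lemma iso_epi A B (f : hom A B) : iso f -> epi f.
Proof.
move=> [g [_ fg]] T u v uv.
by rewrite -[u]comp_idr -[v]comp_idr -fg !comp_assoc uv.
Qed.

Lemma iso_mono A B (f : hom A B) : iso f -> mono f.
Proof.
move=> [g [gf _]] T u v uv.
by rewrite -[u]comp_idl -[v]comp_idl -gf -!comp_assoc uv.
Qed.

Lemma kernel_comp_iso K K' A B (k : hom K A) (f : hom A B) (i : hom K' K) :
  iso i -> is_kernel k f -> is_kernel (k ∘ i) f.
Proof.
move=> ii ker; apply: kernelI.
- exact: mono_comp (kernel_mono ker) (iso_mono ii).
- by rewrite comp_assoc ker.1 comp0l.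
- move=> T u /(kernel_lift ker)[v <-]; have [j [_ ij]] := ii.
  by exists (j ∘ v); rewrite -comp_assoc [i ∘ _]comp_assoc ij comp_idl.
Qed.

Lemma extension1_ses A B (E : extension 1 A B) :
  ses (res_d E 0 ∘ ext_end E) (res_aug E).
Proof.
apply: ses_of_kernel; last exact: res_aug_epi.
apply: kernel_comp_iso (ext_end_iso E) _.
apply: exact_mono_kernel (res_exact0 E) _.
by apply: exact_from_zero (res_exactS E 0) _; apply: ext_zero.
Qed.

Lemma extension2_kernel A B (E : extension 2 A B) :
  is_kernel (res_d E 1 ∘ ext_end E) (res_d E 0).
Proof.
apply: kernel_comp_iso (ext_end_iso E) _.
apply: exact_mono_kernel (res_exactS E 0) _.
by apply: exact_from_zero (res_exactS E 1) _; apply: ext_zero.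
Qed.

Lemma resolution_cokernel A (E : resolution A) :
  is_cokernel (res_aug E) (res_d E 0).
Proof. exact: exact_epi_cokernel (res_exact0 E) (@res_aug_epi _ _ E). Qed.

Lemma is_biproduct_ses A B S (i1 : hom A S) (i2 : hom B S)
    (p1 : hom S A) (p2 : hom S B) :
  p1 ∘ i1 = idm A -> p2 ∘ i2 = idm B -> p2 ∘ i1 = 0 ->
  i1 ∘ p1 + i2 ∘ p2 = idm S -> ses i1 p2.
Proof.
move=> p1i1 p2i2 p2i1 sum; apply: ses_of_kernel.
  apply: kernelI => // [|T u pu].
    by apply: (@mono_compr _ _ _ _ p1); rewrite p1i1; apply: mono_idm.
  exists (p1 ∘ u).
  by rewrite -[RHS]comp_idl -sum comp_addl -!comp_assoc pu comp0r addr0.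
by apply: (@epi_compl _ _ _ _ _ i2); rewrite p2i2; apply: epi_idm.
Qed.

Lemma biproduct_ses A B : exists S (i : hom B S) (p : hom S A) (r : hom S B),
  ses i p /\ r ∘ i = idm B.
Proof.
have [S [i1 [i2 [p1 [p2 [p1i1 p2i2 p1i2 _ sum]]]]]] := has_biproducts A B.
exists S, i2, p1, p2; split=> //.
by apply: is_biproduct_ses p2i2 p1i1 p1i2 _; rewrite addrC.
Qed.

Lemma ses_zero Z A : is_zero Z -> ses (0 : hom Z A) (idm A).
Proof.
move=> Z0; apply: ses_of_kernel (@epi_idm _ _); apply: kernelI (comp_idl _) _.
  by move=> T u v _; rewrite (zero_to u Z0) (zero_to v Z0).
by move=> T u; rewrite comp_idl => ->; exists 0; rewrite comp0l.
Qed.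

(** * Vanishing of Ext^1 and splitting; vanishing of higher Ext *)

Definition ext_retraction A B (E : extension 1 A B) : Prop :=
  exists r, r ∘ (res_d E 0 ∘ ext_end E) = idm B.

(** A section of the augmentation pushes forward along the map, and a retraction onto [B] pulls
    back. *)
Lemma ext_retraction_map A B (E F : extension 1 A B) :
  extension_map E F -> ext_retraction E <-> ext_retraction F.
Proof.
move=> [f [fd fa fe]]; split=> [[r rE]|[r rF]].
  have [s sE] := ses_section (extension1_ses E) rE.
  apply: (ses_retraction (extension1_ses F) (s := f 0%N ∘ s)).
  by rewrite comp_assoc fa.
exists (r ∘ f 0%N).
by rewrite comp_assoc -[r ∘ _ ∘ _]comp_assoc fd -!comp_assoc fe.
Qed.

Lemma yoneda_invariant n A B (P : extension n A B -> Prop) :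
  (forall E F : extension n A B, extension_map E F -> P E <-> P F) ->
  forall E F : extension n A B, yoneda_equiv E F -> P E <-> P F.
Proof.
move=> PE E F; elim=> [E' F' /PE //|//|E' F' _ IH|E' F' G _ IH1 _ IH2].
  exact: iff_sym.
exact: iff_trans IH1 IH2.
Qed.

(** Splitting is invariant under Yoneda equivalence, so it suffices to compare with the biproduct
    extension. Conversely, a retraction of [E] and a section of [F] give an explicit map from [E] to
    [F]. *)
Lemma Ext_vanishes1P A B : Ext_vanishes 1 A B <-> ext1_zero A B.
Proof.
split=> [EF M f g fg|split E F].
  have [Z Z0] := has_zero C; have [S [i [p [r [ip ri]]]]] := biproduct_ses A B.
  pose E := cons_extension fg (trivial_extension Z0 B).
  pose F := cons_extension ip (trivial_extension Z0 B).
  have [r' r'E] : ext_retraction E.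
    apply/(yoneda_invariant (@ext_retraction_map A B) (EF E F)).
    by exists r; rewrite /= !comp_idr.
  by exists r'; rewrite -r'E /= !comp_idr.
have [r rE] := split _ _ _ (extension1_ses E).
have [r' r'F] := split _ _ _ (extension1_ses F).
have [s sF] := ses_section (extension1_ses F) r'F.
have [e [eE Ee]] := ext_end_iso E.
(* Degree 0 identifies both middle terms with a sum of [B] and [A]; degree 1 compares the two copies
   of [B]; the terms above vanish. *)
apply: rst_step; exists (fun i => match i return hom (E i) (F i) with
  | 0%N => res_d F 0 ∘ ext_end F ∘ r + s ∘ res_aug E
  | 1%N => ext_end F ∘ e
  | i.+2 => 0 end); split.
- case=> [|i]; last first.
    by rewrite !(zero_from (_ ∘ _)) //; apply: ext_zero.
  apply: (iso_epi (ext_end_iso E)).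
  rewrite -!comp_assoc eE comp_idr comp_addl -!comp_assoc rE comp_idr.
  by rewrite (ses_comp0 (extension1_ses E)) comp0r addr0.
- rewrite comp_addr !comp_assoc sF comp_idl -[_ ∘ ext_end F]comp_assoc.
  by rewrite (ses_comp0 (extension1_ses F)) comp0l add0r.
- by rewrite -comp_assoc eE comp_idr.
Qed.

(** The first two terms of [E] are replaced by [X] and the pullback [P] of [E 1] along [K -> E 0].
    The map from [P] to [K] has the same kernel as [res_d E 0], so the rest of [E] resolves it
    unchanged. *)
Lemma extension_dominated n K X A B (k : hom K X) (p : hom X A) (kp : ses k p)
    (E : extension n.+2 A B) (u : hom X (E 0%N)) : res_aug E ∘ u = p ->
  exists E' : extension n.+1 K B, extension_map (cons_extension kp E') E.
Proof.
move=> up; have [K0 [k0 [e0 [ker0 ee0 d0E]]]] := res_exact0 E.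
have [K1 [k1 [e1 [ker1 ee1 d1E]]]] := res_exactS E 0.
have [P [a [b pb]]] := exists_pullback (u ∘ k) (res_d E 0).
have [w k0w] : exists w, k0 ∘ w = u ∘ k.
  by apply: (kernel_lift ker0); rewrite comp_assoc up (ses_comp0 kp).
(* The arrow [u ∘ k] lands in the image [K0] of [E 1], so [P] is also a pullback over [K0], where
   [e0] is epi. *)
have ae : epi a.
  have [comm lift inj] := pb; apply: (@pullback_epi C P _ _ _ a b w e0) => //.
  split=> // [|T v v' vv'].
    by apply: (kernel_mono ker0); rewrite !comp_assoc k0w -d0E.
  by apply: lift; rewrite -k0w d0E -!comp_assoc vv'.
have [k' [ker' bk']] := pullback_kernel pb ker1.
have dd i : exact (res_d E i.+2) (res_d E i.+1) by exact: res_exactS.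
have d1k : exact (res_d E 2) (k' ∘ e1).
  apply/(exact_mono_comp _ _ (kernel_mono ker')).
  by apply/(exact_mono_comp _ _ (kernel_mono ker1)); rewrite -d1E.
pose R := @Resolution C K (fun i => if i is j.+1 then E j.+2 else P)
  (fun i => match i with 0%N => k' ∘ e1 | j.+1 => res_d E j.+2 end) a ae
  (ex_intro _ K1 (ex_intro _ k' (ex_intro _ e1 (And3 ker' ee1 erefl))))
  (fun i => match i with 0%N => d1k | j.+1 => res_exactS E j.+2 end).
have R0 i : (n.+1 < i)%N -> is_zero (R i).
  by case: i => // i; exact: (@ext_zero _ _ _ _ E i.+2).
exists (@Extension C n.+1 K B R R0 (ext_end E) (ext_end_iso E)).
exists (fun i => match i return hom (cons_resolution kp R i) (E i) with
  | 0%N => u | 1%N => b | j.+2 => idm (E j.+2) end).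
split=> //=; last by rewrite comp_idl.
case=> [|[|i]] /=; last by rewrite comp_idl comp_idr.
  by have [comm _ _] := pb; rewrite comp_assoc comm.
by rewrite comp_assoc bk' comp_idr d1E.
Qed.

Lemma Ext_vanishes_of_covers (X : set C) B n A :
  (forall A' E0 (p : hom E0 A'), X A' -> epi p ->
     exists K X0 (k : hom K X0) (u : hom X0 E0), X K /\ ses k (p ∘ u)) ->
  (forall A', X A' -> ext1_zero A' B) ->
  X A -> Ext_vanishes n.+1 A B.
Proof.
move=> cover split; elim: n A => [|n IH] A XA.
  exact/Ext_vanishes1P/split.
(* The composite from [P] to [A] is an epi through both augmentations, so a single cover [X0] maps
   to [E 0] and to [F 0] over [A]. *)
move=> E F; have [P [a [b pb]]] := exists_pullback (res_aug E) (res_aug F).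
have pe : epi (res_aug E ∘ a).
  apply: epi_comp; first exact: res_aug_epi.
  exact: pullback_epi pb (@res_aug_epi _ _ F).
have [K [X0 [k [u [XK kp]]]]] := cover _ _ _ XA pe.
have [comm _ _] := pb.
have [|E' E'E] := @extension_dominated n K X0 A B k _ kp E (a ∘ u).
  exact: comp_assoc.
have [|F' F'F] := @extension_dominated n K X0 A B k _ kp F (b ∘ u).
  by rewrite comm comp_assoc.
apply: rst_trans (rst_sym _ _ _ _ (rst_step _ _ _ _ E'E)) _.
apply: rst_trans (rst_step _ _ _ _ F'F).
exact/cons_extension_equiv/IH.
Qed.

(* [d] is the middle arrow of a Yoneda 2-extension whose class vanishes when
   [d] factors through such an [M]; [ext2_cokernel] and [ext2_kernel] show that
   this condition is self-dual. *)
Definition ext2_zero A B : Prop :=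
  forall E1 E0 (y : hom B E1) (d : hom E1 E0) (x : hom E0 A),
    is_kernel y d -> is_cokernel x d ->
    exists M (j : hom E1 M) (e : hom M E0),
      [/\ e ∘ j = d, epi e & is_kernel (j ∘ y) e].

(** The kernel of [j] lies inside that of [d], which is [B], and [j ∘ y] is mono there. An arrow
    killing [j] also kills [j ∘ y], so it descends along [e], and then along [x] because it kills
    [d]. *)
Lemma ext2_cokernel A B E1 E0 M (y : hom B E1) (d : hom E1 E0) (x : hom E0 A)
    (j : hom E1 M) (e : hom M E0) :
  is_kernel y d -> is_cokernel x d -> e ∘ j = d ->
  epi e -> is_kernel (j ∘ y) e ->
  mono j /\ is_cokernel (x ∘ e) j.
Proof.
move=> yd dx ej ee ker; split.
  apply/monoP => T u ju.
  have [v yv] : exists v, y ∘ v = u.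
    by apply: (kernel_lift yd); rewrite -ej -comp_assoc ju comp0r.
  suff v0 : v = 0 by rewrite -yv v0 comp0r.
  by apply: (kernel_mono ker); rewrite comp0r -comp_assoc yv.
apply: cokernelI => [||T t tj].
- exact: epi_comp (cokernel_epi dx) ee.
- by rewrite -comp_assoc ej dx.1.
- have [t' t'e] : exists t', t' ∘ e = t.
    apply: (cokernel_desc (epi_is_cokernel ee ker)).
    by rewrite comp_assoc tj comp0l.
  have [t'' t''x] : exists t'', t'' ∘ x = t'.
    by apply: (cokernel_desc dx); rewrite -ej comp_assoc t'e tj.
  by exists t''; rewrite comp_assoc t''x.
Qed.
End Extensions.

(** * Vanishing of 2-extensions and exact sequences of Ext *)

Section Ext2.
Variable C : abelian.
Implicit Types A B D E K T X Z M : C.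

Lemma ext1_zero_op A B : @ext1_zero (op C) B A <-> ext1_zero A B.
Proof.
split=> H M f g fg.
  have [s gs] := H M g f (conj fg.2 fg.1).
  exact: (ses_retraction fg gs).
have fg' : @ses C _ _ _ g f := conj fg.2 fg.1.
have [r rg] := H M g f fg'.
exact: (ses_section fg' rg).
Qed.

Lemma ext2_kernel A B E1 E0 M (y : hom B E1) (d : hom E1 E0) (x : hom E0 A)
    (j : hom E1 M) (e : hom M E0) :
  is_kernel y d -> is_cokernel x d -> e ∘ j = d ->
  mono j -> is_cokernel (x ∘ e) j ->
  epi e /\ is_kernel (j ∘ y) e.
Proof.
move=> yd dx; exact: (@ext2_cokernel (op C) B A E0 E1 M x d y e j dx yd).
Qed.

Lemma ext2_zero_op A B : ext2_zero A B -> @ext2_zero (op C) B A.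
Proof.
move=> H E1 E0 x d y dx yd.
have [M [j [e [ej ee ker]]]] := H E0 E1 y d x yd dx.
have [jm cok] := @ext2_cokernel C A B E0 E1 M y d x j e yd dx ej ee ker.
by exists M, e, j; split.
Qed.

Lemma ext2_zero_of_op A B : @ext2_zero (op C) B A -> ext2_zero A B.
Proof.
move=> H E1 E0 y d x yd dx.
have [M [e [j [ej jm cok]]]] := H E0 E1 x d y dx yd.
have [ee ker] := ext2_kernel yd dx ej jm cok.
by exists M, j, e; split.
Qed.

(** The condition of [ext2_zero] for a single extension, in a form to which [yoneda_invariant]
    applies. *)
Definition ext2_splits A B (E : extension 2 A B) : Prop :=
  exists M (j : hom (E 1%N) M) (e : hom M (E 0%N)),
    [/\ e ∘ j = res_d E 0, epi e & is_kernel (j ∘ (res_d E 1 ∘ ext_end E)) e].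

Lemma pushout_ses A B D K (h : hom A D) (g : hom A B) (k : hom B K) :
  ses g k -> exists P (g' : hom D P) (h' : hom B P) (k' : hom P K),
    [/\ ses g' k', k' ∘ h' = k, g' ∘ h = h' ∘ g,
      forall T (u : hom D T) (v : hom B T), u ∘ h = v ∘ g ->
          exists w, w ∘ g' = u /\ w ∘ h' = v
    & forall T (u v : hom P T), u ∘ g' = v ∘ g' -> u ∘ h' = v ∘ h' -> u = v].
Proof.
move=> gk; have [P [p [q pb]]] := @exists_pullback (op C) D B A h g.
have [k' [[h1 h2] qk']] := @pullback_of_ses (op C) _ _ _ _ _ _ _ _ _ k pb
  (conj gk.2 gk.1).
have [comm lift inj] := pb.
by exists P, p, q, k'; split.
Qed.

(** An intermediate object [M] for [E] is pushed out along [f 1]; one for [F] is pulled back along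
    [f 0]. *)
Lemma ext2_splits_map A B (E F : extension 2 A B) :
  extension_map E F -> ext2_splits E <-> ext2_splits F.
Proof.
move=> [f [fd fa fe]].
have [yE xE] := (extension2_kernel E, resolution_cokernel E).
have [yF xF] := (extension2_kernel F, resolution_cokernel F).
have f1y : f 1%N ∘ (res_d E 1 ∘ ext_end E) = res_d F 1 ∘ ext_end F.
  by rewrite comp_assoc fd -comp_assoc fe.
split=> [[M [j [e [ej ee ker]]]]|[M [j [e [ej ee ker]]]]].
  have [jm cok] := ext2_cokernel yE xE ej ee ker.
  have [P [g' [h' [k' [g'k' k'h' _ lift inj]]]]] :=
    pushout_ses (f 1%N) (ses_of_cokernel cok jm).
  have [e' [e'g' e'h']] : exists w, w ∘ g' = res_d F 0 /\ w ∘ h' = f 0%N ∘ e.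
    by apply: lift; rewrite -fd -ej comp_assoc.
  have k'E : k' = res_aug F ∘ e'.
    apply: inj; rewrite -comp_assoc ?e'g' ?e'h'.
      by rewrite xF.1 (ses_comp0 g'k').
    by rewrite k'h' comp_assoc fa.
  exists P, g', e'; have := ext2_kernel yF xF e'g' (ses_mono g'k').
  by rewrite -k'E => /(_ g'k'.2)[].
have [P [k' [e' [h' [k'e' h'k' pb]]]]] :=
  pullback_ses (f 0%N) (ses_of_kernel ker ee).
have [_ lift inj] := pb.
have [j' [e'j' h'j']] : exists w, e' ∘ w = res_d E 0 /\ h' ∘ w = j ∘ f 1%N.
  by apply: lift; rewrite fd comp_assoc ej.
exists P, j', e'; split=> //; first exact: ses_epi k'e'.
suff -> : j' ∘ (res_d E 1 ∘ ext_end E) = k' by exact: k'e'.1.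
apply: inj; rewrite comp_assoc ?e'j' ?h'j'.
  by rewrite yE.1 (ses_comp0 k'e').
by rewrite h'k' -comp_assoc f1y.
Qed.

(** Factoring [d] through its image turns the four-term sequence into a splice of two short exact
    sequences, that is, a 2-extension. *)
Lemma Ext_vanishes2_ext2_zero A B : Ext_vanishes 2 A B -> ext2_zero A B.
Proof.
move=> EF E1 E0 y d x yd dx.
have [Z Z0] := has_zero C; have [S [i [p [r [ip ri]]]]] := biproduct_ses A B.
have [K [m [q [mm qe dmq]]]] := image_factorization d.
have yq : ses y q.
  apply: ses_of_kernel => //; apply: kernelI (kernel_mono yd) _ _ => [|T u qu].
    by apply: mm; rewrite comp_assoc -dmq yd.1 comp0r.
  by apply: (kernel_lift yd); rewrite dmq -comp_assoc qu comp0r.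
have mx : ses m x.
  apply: ses_of_cokernel => //.
  apply: cokernelI (cokernel_epi dx) _ _ => [|T u um].
    by apply: qe; rewrite -comp_assoc -dmq dx.1 comp0l.
  by apply: (cokernel_desc dx); rewrite dmq comp_assoc um comp0l.
have BZ : ses (idm B) (0 : hom B Z).
  apply: ses_of_kernel => [|T u v _].
    2: by rewrite (zero_from u Z0) (zero_from v Z0).
  apply: kernelI (@mono_idm _ _) (comp0l _ _) _ => T u _.
  by exists u; rewrite comp_idl.
pose E := cons_extension mx (cons_extension yq (trivial_extension Z0 B)).
(* The zero class, with terms [B], [B], [A], [A] and zero middle arrow; the biproduct of [A] and [B]
   serves as its intermediate object. *)
pose F := cons_extension (ses_zero A Z0)
  (cons_extension BZ (trivial_extension Z0 B)).
have [M [j [e [ej ee ker]]]] : ext2_splits E.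
  apply/(yoneda_invariant (@ext2_splits_map A B) (EF E F)).
  exists S, i, p; split; first by rewrite /= comp0l (ses_comp0 ip).
    exact: ses_epi ip.
  by rewrite /= !comp_idr; exact: ip.1.
exists M, j, e; split=> //; first by rewrite ej dmq.
by move: ker; rewrite /= !comp_idr.
Qed.

(* The long exact sequence of Ext(-, Z) at Ext^1(A, Z). *)
Lemma ext1_zero_kernel A B D Z (i : hom A B) (p : hom B D) :
  ses i p -> ext2_zero D Z -> ext1_zero B Z -> ext1_zero A Z.
Proof.
move=> ip DZ BZ E f g fg.
have ker : is_kernel f (i ∘ g).
  apply: kernelI (ses_mono fg) _ _ => [|T u].
    by rewrite -comp_assoc (ses_comp0 fg) comp0r.
  rewrite -comp_assoc => iu; apply: (kernel_lift fg.1).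
  by apply: (ses_mono ip); rewrite iu comp0r.
have cok : is_cokernel p (i ∘ g).
  apply: cokernelI (ses_epi ip) _ _ => [|T u].
    by rewrite comp_assoc (ses_comp0 ip) comp0l.
  rewrite comp_assoc => iu; apply: (cokernel_desc ip.2).
  by apply: (ses_epi fg); rewrite iu comp0l.
(* Here [M] is an extension of [B] by [Z], so it splits; composing its retraction with [j] retracts
   [E] onto [Z]. *)
have [M [j [e [_ ee kere]]]] := DZ _ _ _ _ _ ker cok.
have [r rj] := BZ _ _ _ (ses_of_kernel kere ee).
by exists (r ∘ j); rewrite -comp_assoc.
Qed.

(** The pushout of the sequence along [u] is an extension of [B] by [Z], hence splits. *)
Lemma ext1_zero_extends A Z E B (i : hom A E) (p : hom E B) (u : hom A Z) :
  ext1_zero B Z -> ses i p -> exists v, v ∘ i = u.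
Proof.
move=> BZ ip; have [P [g' [h' [k' [g'k' _ comm _ _]]]]] := pushout_ses u ip.
have [r rg'] := BZ _ _ _ g'k'.
by exists (r ∘ h'); rewrite -comp_assoc -comm comp_assoc rg' comp_idl.
Qed.

Lemma ext1_zero_lifts A X E B (i : hom B E) (p : hom E A) (u : hom X A) :
  ext1_zero X B -> ses i p -> exists v, p ∘ v = u.
Proof.
move=> XB ip.
have [P [k' [g' [h' [k'g' _ [comm _ _]]]]]] := pullback_ses u ip.
have [r rk'] := XB _ _ _ k'g'.
have [s gs] := ses_section k'g' rk'.
by exists (h' ∘ s); rewrite comp_assoc -comm -comp_assoc gs comp_idr.
Qed.

(** The preimage [L] of [A] in [E] is an extension of [A] by [Z]. It retracts onto [Z], and the
    retraction extends from [L] to [E] because the quotient is [D]. *)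
Lemma ext1_zero_extension A B D Z (i : hom A B) (p : hom B D) :
  ses i p -> ext1_zero A Z -> ext1_zero D Z -> ext1_zero B Z.
Proof.
move=> ip AZ DZ E f g fg.
have [L [l [j [q [lpg jq lj]]]]] := noether_ses ip fg.
have [r rj] := AZ _ _ _ jq.
have [v vl] := ext1_zero_extends r DZ lpg.
by exists v; rewrite -lj comp_assoc vl.
Qed.

Lemma ext1_zero_retract A B Z (s : hom A B) (r : hom B A) :
  r ∘ s = idm A -> ext1_zero B Z -> ext1_zero A Z.
Proof.
move=> rs BZ E f g fg; have [t gt] := ext1_zero_lifts r BZ fg.
by apply: (ses_retraction fg (s := t ∘ s)); rewrite comp_assoc gt.
Qed.

Lemma ext1_zero_zero A Z : is_zero A -> ext1_zero A Z.
Proof.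
move=> A0 E f g fg; apply: (ses_retraction fg (s := 0)).
by rewrite comp0r; apply/esym/is_zeroP.
Qed.
End Ext2.

(** * Cotorsion pairs and resolution dimension *)

Section Classes.
Variable C : abelian.
Implicit Types (A B D K Z : C) (X Y W : set C).

Lemma lperpP Y A : lperp Y A <-> forall B, Y B -> ext1_zero A B.
Proof. by split=> H B /H /Ext_vanishes1P. Qed.

Lemma rperpP X B : rperp X B <-> forall A, X A -> ext1_zero A B.
Proof. by split=> H A /H /Ext_vanishes1P. Qed.

Lemma lperp_extension Y A B D (f : hom A B) (g : hom B D) :
  ses f g -> lperp Y A -> lperp Y D -> lperp Y B.
Proof.
move=> fg /lperpP YA /lperpP YD; apply/lperpP => Z YZ.
exact: ext1_zero_extension fg (YA Z YZ) (YD Z YZ).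
Qed.

Lemma lperp_retract Y A B (s : hom A B) (r : hom B A) :
  r ∘ s = idm A -> lperp Y B -> lperp Y A.
Proof.
by move=> rs /lperpP YB; apply/lperpP => Z /YB; apply: ext1_zero_retract rs.
Qed.

Lemma additive_lperp Y : additive_class (lperp Y).
Proof.
split.
- by move=> Z Z0; apply/lperpP => B _; apply: ext1_zero_zero.
- move=> A B S [i1 [i2 [p1 [p2 [p1i1 p2i2 _ p2i1 sum]]]]].
  exact: (lperp_extension (is_biproduct_ses p1i1 p2i2 p2i1 sum)).
- by move=> A B f [g [_ fg]]; apply: lperp_retract fg.
Qed.

Lemma left_completeP X Y : left_complete X Y ->
  forall A, exists B D (f : hom B D) (g : hom D A), [/\ ses f g, X D & Y B].
Proof.
by move=> H A; have [B [D [f [g [/short_exactP fg ? ?]]]]] := H A;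
  exists B, D, f, g.
Qed.

Lemma right_completeP X Y : right_complete X Y ->
  forall A, exists B D (f : hom A B) (g : hom B D), [/\ ses f g, Y B & X D].
Proof.
by move=> H A; have [B [D [f [g [/short_exactP fg ? ?]]]]] := H A;
  exists B, D, f, g.
Qed.

Lemma thickP W A B D (f : hom A B) (g : hom B D) : thick W -> ses f g ->
  [/\ W A -> W B -> W D, W A -> W D -> W B & W B -> W D -> W A].
Proof. by move=> [_ H] /short_exactP/H. Qed.

(** The last clause, that every object is a quotient of one in [X], stands in for the usual
    requirement that [X] contain the projectives. *)
Definition resolving X : Prop :=
  [/\ additive_class X,
      forall A B D (f : hom A B) (g : hom B D), ses f g -> X A -> X D -> X B,
      forall A B D (f : hom A B) (g : hom B D), ses f g -> X B -> X D -> X A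
    & forall A, exists K E (k : hom K E) (p : hom E A), ses k p /\ X E].

(** The form in which heredity enters the arguments below; unlike the definition by resolutions, it
    passes directly to the opposite category. *)
Definition ext2_orthogonal X Y : Prop :=
  forall A B, X A -> Y B -> ext2_zero A B.

Lemma resolving_cotorsion X Y :
  complete_cotorsion_pair X Y -> ext2_orthogonal X Y -> resolving X.
Proof.
move=> [[_ XE] lc _] XY; split.
- by rewrite XE; apply: additive_lperp.
- by move=> A B D f g fg; rewrite XE; apply: lperp_extension fg.
- move=> A B D f g fg XB XD; rewrite XE; apply/lperpP => Z YZ.
  apply: ext1_zero_kernel fg (XY _ _ XD YZ) _.
  by move: XB; rewrite XE => /lperpP; apply.
- move=> A; have [K [E [k [p [kp XEE _]]]]] := left_completeP lc A.
  by exists K, E, k, p.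
Qed.

(** Vanishing of Ext^2 makes [X] resolving, and this supplies the covers needed by
    [Ext_vanishes_of_covers]. *)
Lemma hereditary_of_ext2 X Y :
  complete_cotorsion_pair X Y -> ext2_orthogonal X Y -> hereditary X Y.
Proof.
move=> XY XY2 A B [//|n] XA YB _.
have [_ _ Xker Xcover] := resolving_cotorsion XY XY2.
have [[_ XE] _ _] := XY.
apply: (@Ext_vanishes_of_covers C X B n A _ _ XA) => [A' E0 p XA' pe|A'].
  have [K0 [X0 [k0 [u [k0u XX0]]]]] := Xcover E0.
  have [K [k kp]] := epi_ses (epi_comp pe (ses_epi k0u)).
  by exists K, X0, k, u; split=> //; apply: Xker kp XX0 XA'.
by rewrite XE => /lperpP; apply.
Qed.

Lemma hereditary_ext2 X Y : hereditary X Y -> ext2_orthogonal X Y.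
Proof.
by move=> H A B XA YB; apply: Ext_vanishes2_ext2_zero; apply: H.
Qed.

Fixpoint rdim n X : set C :=
  if n is m.+1 then
    [set A | exists K E (k : hom K E) (p : hom E A),
       [/\ ses k p, X E & rdim m X K]]
  else X.

(** A resolution is cut at its first syzygy [K] and rebuilt by splicing. For [n = 0] it only gives
    an isomorphism onto [A], whence the closure hypothesis. *)
Lemma resdim_leE n X :
  (forall A B (f : hom A B), iso f -> X A -> X B) -> resdim_le n X = rdim n X.
Proof.
move=> Xiso; apply/seteqP; split; elim: n => [|n IH] A /=.
- move=> [E [XE E0]]; apply: (Xiso _ _ (res_aug E)) (XE 0%N _) => //.
  apply: mono_epi_iso (@res_aug_epi _ _ E).
  exact: exact_from_zero (res_exact0 E) (E0 1%N _).
- move=> [E [XE E0]]; have [K [k [e [ker ee d0E]]]] := res_exact0 E.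
  have ee0 : exact (res_d E 1) e.
    apply/(exact_mono_comp _ _ (kernel_mono ker)); rewrite -d0E.
    exact: res_exactS.
  exists K, (E 0%N), k, (res_aug E); split; [| |apply: IH].
  + exact: ses_of_kernel ker (@res_aug_epi _ _ E).
  + exact: XE.
  + exists (@Resolution C K (fun i => E i.+1) (fun i => res_d E i.+1) e
      ee ee0 (fun i => res_exactS E i.+1)).
    by split=> i ni /=; [apply: XE|apply: E0].
- move=> XA; have [Z Z0] := has_zero C.
  by exists (single_resolution Z0 A); split; case.
- move=> [K [E [k [p [kp XE /IH[F [XF F0]]]]]]].
  by exists (cons_resolution kp F); split; case.
Qed.

(** * Resolution dimension with respect to a resolving class *)

Section Resolving.
Variable X : set C.
Hypothesis Xres : resolving X.

Let Xext A B D (f : hom A B) (g : hom B D) : ses f g -> X A -> X D -> X B.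
Proof. by have [_ H _ _] := Xres; apply: H. Qed.

Let Xker A B D (f : hom A B) (g : hom B D) : ses f g -> X B -> X D -> X A.
Proof. by have [_ _ H _] := Xres; apply: H. Qed.

Lemma rdim_resdim n : resdim_le n X = rdim n X.
Proof. by apply: resdim_leE; have [[]] := Xres. Qed.

Lemma rdimS n : rdim n X `<=` rdim n.+1 X.
Proof.
elim: n => [A XA|n IH A [K [E [k [p [kp XE /IH XK]]]]]].
  2: by exists K, E, k, p.
have [Z Z0] := has_zero C; exists Z, A, 0, (idm A); split=> //.
  exact: ses_zero.
by have [[+ _ _] _ _ _] := Xres; apply.
Qed.

Lemma rdim_ge0 n : X `<=` rdim n X.
Proof. by elim: n => [//|n IH] A /IH/rdimS. Qed.

(** The preimage [L] of [A] in the cover [E] of [B] is the kernel of an epi from [E] to [D], hence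
    in [X]; it covers [A] with the same kernel [K]. *)
Lemma rdim_kernel n A B D (f : hom A B) (g : hom B D) :
  ses f g -> rdim n X B -> X D -> rdim n X A.
Proof.
case: n => [|n] fg /=; first exact: Xker fg.
move=> [K [E [k [p [kp XE XK]]]]] XD.
have [L [l [j [q [lgp jq _]]]]] := noether_ses fg kp.
by exists K, L, j, q; split=> //; apply: Xker lgp XE XD.
Qed.

(** A simultaneous induction. Extensions at [n] give syzygies at [n]: the pullback of [B] and the
    cover of [D] is an extension of [B] by [K], and [A] is the kernel of its map to [E]. Syzygies at
    [n] give extensions at [n.+1]: the kernel of a cover of [B] is also a syzygy of [A]. *)
Lemma rdim_extension_syzygy n :
  (forall A B D (f : hom A B) (g : hom B D),
     ses f g -> rdim n X A -> X D -> rdim n X B) /\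
  (forall A B D (f : hom A B) (g : hom B D),
     ses f g -> X B -> rdim n.+1 X D -> rdim n X A).
Proof.
have syz m : (forall A B D (f : hom A B) (g : hom B D),
     ses f g -> rdim m X A -> X D -> rdim m X B) ->
  (forall A B D (f : hom A B) (g : hom B D),
     ses f g -> X B -> rdim m.+1 X D -> rdim m X A).
  move=> ext A B D f g fg XB [K [E [k [p [kp XE XK]]]]].
  have [P [k' [g' [l' [h' [kg' lh']]]]]] := pullback_ses2 kp fg.
  exact: rdim_kernel lh' (ext _ _ _ _ _ kg' XK XB) XE.
elim: n => [|n [_ IH]]; first by split; [exact: Xext|exact: (syz 0%N (@Xext))].
suff ext A B D (f : hom A B) (g : hom B D) :
    ses f g -> rdim n.+1 X A -> X D -> rdim n.+1 X B.
  by split=> //; apply: (syz n.+1).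
move=> fg XA XD; have [_ _ _ cover] := Xres.
have [K [E [k [p [kp XE]]]]] := cover B.
have [L [l [j [q [lgp jq _]]]]] := noether_ses fg kp.
by exists K, E, k, p; split=> //; apply: IH jq (Xker lgp XE XD) XA.
Qed.

Lemma rdim_extension n A B D (f : hom A B) (g : hom B D) :
  ses f g -> rdim n X A -> X D -> rdim n X B.
Proof. by have [H _] := rdim_extension_syzygy n; apply: H. Qed.

Lemma rdim_syzygy n A B D (f : hom A B) (g : hom B D) :
  ses f g -> X B -> rdim n X D -> rdim n X A.
Proof.
move=> fg XB /rdimS XD; have [_ H] := rdim_extension_syzygy n.
exact: H fg XB XD.
Qed.

Lemma rdimS_syzygy n A B D (f : hom A B) (g : hom B D) :
  ses f g -> X B -> rdim n.+1 X D -> rdim n X A.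
Proof. by have [_ H] := rdim_extension_syzygy n; apply: H. Qed.

(** Pulling the cover of [D] back to [B] gives an extension of [E] by [A], which lies in [X] and
    covers [B] with kernel [K]. *)
Lemma rdim_extension_left n A B D (f : hom A B) (g : hom B D) :
  ses f g -> X A -> rdim n X D -> rdim n X B.
Proof.
case: n => [|n] fg XA /=; first exact: Xext fg XA.
move=> [K [E [k [p [kp XE XK]]]]].
have [P [k' [g' [l' [h' [kg' lh']]]]]] := pullback_ses2 kp fg.
by exists K, P, k', g'; split=> //; apply: Xext lh' XA XE.
Qed.

End Resolving.
End Classes.

(** * Duality *)

Section Duality.
Variable C : abelian.
Implicit Types (A B D K Z : C) (X Y W Q R : set C).

Lemma ses_op A B D (f : hom A B) (g : hom B D) :
  ses f g -> @ses (op C) D B A g f.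
Proof. by case. Qed.

Lemma ses_of_op A B D (f : hom A B) (g : hom B D) :
  @ses (op C) D B A g f -> ses f g.
Proof. by case. Qed.

Lemma pushout_ses2 A B D K L (k : hom B K) (g : hom D B)
    (l : hom A L) (h : hom D A) :
  ses g k -> ses h l ->
  exists P (g' : hom A P) (k' : hom P K) (h' : hom B P) (l' : hom P L),
    ses g' k' /\ ses h' l'.
Proof.
move=> /ses_op kg /ses_op lh.
have [P [k' [g' [l' [h' [kg' lh']]]]]] := pullback_ses2 kg lh.
by exists P, g', k', h', l'; split; apply: ses_of_op.
Qed.

Lemma noether_ses_dual K P D K' E (k : hom P K) (g : hom D P)
    (k' : hom E K') (q : hom P E) :
  ses g k -> ses q k' ->
  exists L (l : hom E L) (j : hom L K') (q' : hom K L),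
    ses (q ∘ g) l /\ ses q' j.
Proof.
move=> /ses_op kg /ses_op k'q.
have [L [l [j [q' [lgq jq' _]]]]] := noether_ses kg k'q.
by exists L, l, j, q'; split; apply: ses_of_op.
Qed.

Lemma short_exact_op A B D (f : hom A B) (g : hom B D) :
  @short_exact (op C) D B A g f <-> short_exact f g.
Proof.
split=> [/(@short_exactP (op C))/ses_of_op|] H; apply/short_exactP => //.
exact/ses_op/short_exactP.
Qed.

(** The passage through [ext1_zero] is what makes this symmetric: Yoneda extensions are encoded by
    resolutions of one end only. *)
Lemma lperp_op X : @lperp (op C) X = @rperp C X.
Proof.
by apply/seteqP; split=> A H B XB; apply/Ext_vanishes1P/ext1_zero_op;
  apply/Ext_vanishes1P/H.
Qed.

Lemma rperp_op X : @rperp (op C) X = @lperp C X.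
Proof.
by apply/seteqP; split=> A H B XB; apply/Ext_vanishes1P/ext1_zero_op;
  apply/Ext_vanishes1P/H.
Qed.

Lemma complete_cotorsion_pair_op X Y :
  @complete_cotorsion_pair (op C) Y X <-> complete_cotorsion_pair X Y.
Proof.
split=> [[[XY YX] lc rc]|[[XY YX] lc rc]]; split.
- by split; rewrite -?lperp_op -?rperp_op.
- move=> A; have [B [D [f [g [fg YB XD]]]]] := rc A.
  by exists D, B, g, f; split=> //; apply/short_exact_op.
- move=> A; have [B [D [f [g [fg YB XD]]]]] := lc A.
  by exists D, B, g, f; split=> //; apply/short_exact_op.
- by split; rewrite ?lperp_op ?rperp_op.
- move=> A; have [B [D [f [g [fg YB XD]]]]] := rc A.
  by exists D, B, g, f; split=> //; apply/short_exact_op.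
- move=> A; have [B [D [f [g [fg YB XD]]]]] := lc A.
  by exists D, B, g, f; split=> //; apply/short_exact_op.
Qed.

Lemma additive_class_op X : @additive_class (op C) X <-> additive_class X.
Proof.
split=> -[X0 XB Xi]; split.
- by move=> Z /is_zero_op; apply: X0.
- by move=> A B S /is_biproduct_op; apply: XB.
- by move=> A B f [g [gf fg]]; apply: (Xi A B g); exists f.
- by move=> Z /is_zero_op; apply: X0.
- by move=> A B S /is_biproduct_op; apply: XB.
- by move=> A B f [g [gf fg]]; apply: (Xi A B g); exists f.
Qed.

Lemma thick_op W : @thick (op C) W <-> thick W.
Proof.
split=> -[Wr W3]; split.
- by move=> A B S /is_biproduct_op; apply: Wr.
- by move=> A B D f g /short_exact_op/W3[h1 h2 h3]; split=> *; auto.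
- by move=> A B S /is_biproduct_op; apply: Wr.
- by move=> A B D f g /short_exact_op/W3[h1 h2 h3]; split=> *; auto.
Qed.

Lemma hovey_triple_op Q W R : @hovey_triple (op C) R W Q <-> hovey_triple Q W R.
Proof.
split=> -[[aQ aW aR] tW QR QR'].
  split; first by split; apply/additive_class_op.
  - exact/thick_op.
  - by rewrite setIC; apply/complete_cotorsion_pair_op.
  - by rewrite setIC; apply/complete_cotorsion_pair_op.
split; first by split; apply/additive_class_op.
- exact/thick_op.
- by rewrite setIC; apply/complete_cotorsion_pair_op.
- by rewrite setIC; apply/complete_cotorsion_pair_op.
Qed.

(** Only Ext^2 is carried across the duality; the higher groups are then recovered from
    completeness. *)
Lemma hereditary_of_op X Y : complete_cotorsion_pair X Y ->
  @hereditary (op C) Y X -> hereditary X Y.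
Proof.
move=> XY H; apply: hereditary_of_ext2 => // A B XA YB.
exact/ext2_zero_of_op/(@hereditary_ext2 (op C) Y X).
Qed.

Lemma exact_op A B D (f : hom A B) (g : hom B D) :
  exact f g -> @exact (op C) D B A g f.
Proof. by move=> /exact_cokernel. Qed.

Lemma exact_of_op A B D (f : hom A B) (g : hom B D) :
  @exact (op C) D B A g f -> exact f g.
Proof. by move=> /(@exact_cokernel (op C)). Qed.

Lemma resdim_le_op n X : @resdim_le (op C) n X = @coresdim_le C n X.
Proof.
apply/seteqP; split=> A [E [XE E0]].
  exists (@Coresolution C A E (@res_d _ _ E) (res_aug E) (@res_aug_epi _ _ E)
    (exact_of_op (res_exact0 E)) (fun i => exact_of_op (res_exactS E i))).
  by split=> // i /E0/is_zero_op.
exists (@Resolution (op C) A E (@cores_d _ _ E) (cores_aug E)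
  (@cores_aug_mono _ _ E)
  (exact_op (cores_exact0 E)) (fun i => exact_op (cores_exactS E i))).
by split=> // i /E0/is_zero_op.
Qed.

Lemma additive_rperp X : additive_class (rperp X).
Proof.
by apply/additive_class_op; rewrite -lperp_op; apply: additive_lperp.
Qed.

End Duality.

(** * Hovey triples *)

Section ResolutionDimension.
Variable C : abelian.
Variables Q W R : set C.
Hypothesis QWR : hovey_triple Q W R.
Hypothesis QWR2 : ext2_orthogonal Q (W `&` R).

Let thickW : thick W.
Proof. by have [] := QWR. Qed.

Let resQ : resolving Q.
Proof. by have [_ _ QR _] := QWR; apply: resolving_cotorsion QWR2. Qed.

Lemma resdim_trivial n : resdim_le n (Q `&` W) = resdim_le n Q `&` W.
Proof.
have [[_ _ Qiso] [_ _ Wiso] _] : [/\ additive_class Q, additive_class W & True].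
  by have [[]] := QWR.
rewrite !resdim_leE //.
  2: by move=> A B f fi [/(Qiso _ _ _ fi) + /(Wiso _ _ _ fi)].
apply/seteqP; split; elim: n => [//|n IH] A.
  move=> [K [E [k [p [kp [QE WE] /IH[QK WK]]]]]].
  split; first by exists K, E, k, p.
  by have [+ _ _] := thickP thickW kp; apply.
(* The kernel of a special [Q]-precover of [A] lies in [W], so by thickness the precover does too;
   the induction continues with the kernel as a syzygy. *)
move=> [QA WA]; have [_ _ [_ lc _] _] := QWR.
have [K [E [k [p [kp QE [WK _]]]]]] := left_completeP lc A.
exists K, E, k, p; have [_ WKA _] := thickP thickW kp; split=> //.
  by split=> //; apply: WKA.
by apply: IH; split=> //; apply: rdimS_syzygy kp QE QA.
Qed.

Variable n : nat.
Let QWn := resdim_le n (Q `&` W).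
Let Qn := resdim_le n Q.
Hypothesis completeQWn : complete_cotorsion_pair QWn (rperp QWn).

Let QnE : Qn = rdim n Q.
Proof. exact: rdim_resdim. Qed.

Let QWnE : QWn = Qn `&` W.
Proof. exact: resdim_trivial. Qed.

(** Taking right orthogonals reverses the inclusion of Q ∩ W in [QWn], and [R] is the orthogonal of
    the former. *)
Let rperp_sub_WR : W `&` rperp QWn `<=` W `&` R.
Proof.
move=> Z [WZ QZ]; split=> //; have [_ _ _ [[<- _] _ _]] := QWR.
move=> A [QA WA]; apply: QZ; rewrite QWnE QnE; split=> //.
exact: rdim_ge0.
Qed.

(** One inclusion holds because [Qn] contains both [Q] and [QWn]; the other shifts the dimension
    along an embedding of [A] into an object of [QWn] with cokernel in [Q]. *)
Lemma rperp_resdim : rperp Qn = W `&` rperp QWn.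
Proof.
have [_ _ [[QWR_E _] _ rc] _] := QWR.
apply/seteqP; split=> [Z QZ|Z WZ].
  split; last by move=> A; rewrite QWnE => -[QA _]; apply: QZ.
  suff [] : (W `&` R) Z by [].
  by rewrite -QWR_E => A QA; apply: QZ; rewrite QnE; apply: rdim_ge0.
apply/rperpP => A QA.
have [B [D [f [g [fg [WB RB] QD]]]]] := right_completeP rc A.
apply: (ext1_zero_kernel fg (QWR2 QD (rperp_sub_WR WZ))).
move: WZ => [_ /rperpP]; apply; rewrite QWnE; split=> //.
by move: QA; rewrite QnE => QA; apply: rdim_extension fg QA QD.
Qed.

(** The kernel [Y] of a special [Q]-precover of [A] is enlarged to [R1] by pushout. The new middle
    term [X] is an extension of [L] in [QWn] by [Q0] in [Q], hence in [Qn]. *)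
Lemma left_complete_resdim : left_complete Qn (rperp Qn).
Proof.
have [_ _ [_ lc _] _] := QWR; have [_ _ rc] := completeQWn => A.
have [Y [Q0 [y [q [yq QQ0 [WY _]]]]]] := left_completeP lc A.
have [R1 [L [r [l [rl RR1 QL]]]]] := right_completeP rc Y.
have [X [h [m [f [g [hm fg]]]]]] := pushout_ses2 yq rl.
move: QL; rewrite QWnE => -[QL WL].
exists R1, X, h, m; split; first exact/short_exactP.
- by move: QL; rewrite QnE => QL; apply: rdim_extension_left fg QQ0 QL.
- rewrite rperp_resdim; split=> //.
  by have [_ + _] := thickP thickW rl; apply.
Qed.

(** Two embeddings are composed, from [A] to [B] to [Z]; the cokernel of the composite is an
    extension of [L] in [QWn] by [D] in [Q]. *)
Lemma right_complete_resdim : right_complete Qn (rperp Qn).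
Proof.
have [_ _ [_ _ rcQ] _] := QWR; have [_ _ rc] := completeQWn => A.
have [B [D [f [g [fg [WB _] QD]]]]] := right_completeP rcQ A.
have [Z [L [z [l [zl RZ QL]]]]] := right_completeP rc B.
have [X [h [m [h' [fh hm]]]]] := noether_ses_dual fg zl.
move: QL; rewrite QWnE => -[QL WL].
exists Z, X, (z ∘ f), h; split; first exact/short_exactP.
- rewrite rperp_resdim; split=> //.
  by have [_ + _] := thickP thickW zl; apply.
- by move: QL; rewrite QnE => QL; apply: rdim_extension_left hm QD QL.
Qed.

(** Let [A] be left orthogonal to [rperp Qn]. It embeds in some [B] in [W] with cokernel in [Q], and
    [B] is again left orthogonal. The special [QWn]-precover of [B] has its kernel in [W], hence in
    [rperp Qn], so it splits. Thus [B] is in [QWn], and [A], as a kernel of an epi from [B] to an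
    object of [Q], is in [Qn]. *)
Lemma cotorsion_pair_resdim : cotorsion_pair Qn (rperp Qn).
Proof.
split=> //; apply/seteqP; split=> [A QA Z /(_ A QA)//|A QA].
have [_ _ [_ _ rcQ] _] := QWR; have [[_ QWn_lperp] lc _] := completeQWn.
have [B [D [f [g [fg [WB _] QD]]]]] := right_completeP rcQ A.
have QQn D' : Q D' -> Qn D' by rewrite QnE; apply: rdim_ge0.
have QB : lperp (rperp Qn) B.
  by apply: lperp_extension fg QA _ => Z; apply; apply: QQn.
have QWB : QWn B.
  have [K [E [k [p [kp QE RK]]]]] := left_completeP lc B.
  have WK : W K.
    move: QE; rewrite QWnE => -[_ WE].
    by have [_ _] := thickP thickW kp; apply.
  have [s ps] : exists s, p ∘ s = idm B.
    apply: ext1_zero_lifts kp; move/lperpP: QB; apply.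
    by rewrite rperp_resdim.
  by rewrite QWn_lperp; apply: lperp_retract ps _; rewrite -QWn_lperp.
move: QWB; rewrite QWnE QnE => -[QB' _].
exact: rdim_kernel fg QB' QD.
Qed.

Lemma complete_resdim : complete_cotorsion_pair Qn (rperp Qn).
Proof.
split; [exact: cotorsion_pair_resdim|exact: left_complete_resdim|].
exact: right_complete_resdim.
Qed.

(** Covers by objects of [Q] suffice, since their kernels over objects of [Qn] are syzygies and stay
    in [Qn]. *)
Lemma hereditary_resdim : hereditary Qn (rperp Qn).
Proof.
move=> A B [//|m] QA QB _.
apply: (@Ext_vanishes_of_covers C Qn B m A _ _ QA) => [A' E0 p QA' pe|].
  have [_ _ _ cover] := resQ; have [K0 [X0 [k0 [u [k0u QX0]]]]] := cover E0.
  have [K [k kp]] := epi_ses (epi_comp pe (ses_epi k0u)).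
  exists K, X0, k, u; split=> //; move: QA'.
  by rewrite QnE => QA'; apply: rdim_syzygy kp QX0 QA'.
by apply/rperpP.
Qed.

(** The covers now come from the pair (Q ∩ W, R), so that thickness keeps the kernels in [W] as
    well. *)
Lemma hereditary_resdim_trivial : hereditary QWn (rperp QWn).
Proof.
move=> A B [//|m] QA QB _.
apply: (@Ext_vanishes_of_covers C QWn B m A _ _ QA) => [A' E0 p QA' pe|].
  have [_ _ _ [_ lc _]] := QWR.
  have [K0 [X0 [k0 [u [k0u [QX0 WX0] _]]]]] := left_completeP lc E0.
  have [K [k kp]] := epi_ses (epi_comp pe (ses_epi k0u)).
  exists K, X0, k, u; split=> //; move: QA'.
  rewrite QWnE QnE => -[QA' WA']; split; first exact: rdim_syzygy kp QX0 QA'.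
  by have [_ _ +] := thickP thickW kp; apply.
by apply/rperpP.
Qed.

Lemma hovey_triple_resdim :
  hereditary_hovey_triple Qn W (rperp QWn) /\
  [/\ complete_cotorsion_pair Qn (rperp Qn),
      hereditary Qn (rperp Qn),
      rperp Qn = W `&` rperp QWn
    & special_precovering Qn].
Proof.
split; last first.
  split; [exact: complete_resdim|exact: hereditary_resdim|exact: rperp_resdim|].
  move=> A.
  have [B [D [f [g [fg QD RB]]]]] := left_completeP left_complete_resdim A.
  exists D, g; split=> //; first exact: ses_epi fg.
  by exists B, f; split=> //; case: fg.
have [[_ addW _] _ _ _] := QWR.
split; rewrite -?rperp_resdim -?QWnE.
- split.
  + split=> //; last exact: additive_rperp.
    by have [_ ->] := cotorsion_pair_resdim; apply: additive_lperp.
  + exact: thickW.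
  + by rewrite -rperp_resdim; apply: complete_resdim.
  + by rewrite -QWnE.
- exact: hereditary_resdim.
- exact: hereditary_resdim_trivial.
Qed.

End ResolutionDimension.

Theorem theoremA (C : abelian) (Q W R : set C)
    (hQWR : hereditary_hovey_triple Q W R) (n : nat) :
  let QWn := resdim_le n (Q `&` W) in
  let Qn := resdim_le n Q in
  let RWn := coresdim_le n (W `&` R) in
  let Rn := coresdim_le n R in
  (complete_cotorsion_pair QWn (rperp QWn) ->
     hereditary_hovey_triple Qn W (rperp QWn) /\
     [/\ complete_cotorsion_pair Qn (rperp Qn),
         hereditary Qn (rperp Qn),
         rperp Qn = W `&` rperp QWn
       & special_precovering Qn]) /\
  (complete_cotorsion_pair (lperp RWn) RWn ->
     hereditary_hovey_triple (lperp RWn) W Rn /\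
     [/\ complete_cotorsion_pair (lperp Rn) Rn,
         hereditary (lperp Rn) Rn,
         lperp Rn = W `&` lperp RWn
       & special_preenveloping Rn]).
Proof.
have [QWR herQ herR] := hQWR; split.
  exact: hovey_triple_resdim QWR (hereditary_ext2 herQ) n.
(* For the second assertion, the triple is read backwards in the opposite category, and the pair (Q
   ∩ W, R) takes over the role of (Q, W ∩ R). *)
have QWRop : @hovey_triple (op C) R W Q by apply/hovey_triple_op.
have QWRop2 : @ext2_orthogonal (op C) R (W `&` Q).
  move=> A B RA WB; apply: ext2_zero_op; apply: (hereditary_ext2 herR) => //.
  by rewrite setIC.
have := hovey_triple_resdim QWRop QWRop2 (n := n).
rewrite !resdim_le_op [R `&` W]setIC !rperp_op => H /complete_cotorsion_pair_op.
move=> /H [[/hovey_triple_op Hov her1 her2]].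
move=> [/complete_cotorsion_pair_op cot her eq pre].
have [_ _ cot1 cot2] := Hov.
split; first split=> //.
(* Heredity returns from the opposite category by means of the complete cotorsion pairs just
   transported. *)
- by apply: hereditary_of_op => //; rewrite setIC.
- by apply: hereditary_of_op => //; rewrite setIC.
split=> //; first exact: hereditary_of_op.
move=> A; have [D [p [RD pe [K [k [ker RK]]]]]] := pre A.
by exists D, p; split=> //; exists K, k; move: RK; rewrite rperp_op.
Qed.
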